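(* Let $d\ge 1$. (a) A function $f$ on $(0,\infty)^d$ belongs to $\mathcal F_{SMU}(d)=\{f_G : G\in\mathcal G_d\}$ if and only if $f\equiv f_G$, where $G\in\mathcal G_d$ is given by $$G(\boldsymbol x)=\int_{(0,\infty)^d}(-1)^d\,V_f(\boldsymbol u,\boldsymbol x]\cdot \mathbf 1_{[\boldsymbol u\le \boldsymbol x]}\,d\boldsymbol u ,\qquad \boldsymbol x\in(0,\infty)^d .$$ Thus there is a one-to-one correspondence between $G\in\mathcal G_d$ and $f_G\in\mathcal F_{SMU}(d)$. (b) Let $f:(0,\infty)^d\to[0,\infty)$ be an upper semi-continuous probability density with respect to Lebesgue measure which converges to zero as any one coordinate tends to $\infty$ with all other coordinates kept fixed. Then $f\in\mathcal F_{SMU}(d)$ if and only if $(-1)^dV_f[\boldsymbol x,\boldsymbol y)\ge 0$ for all $\boldsymbol x\le\boldsymbol y$ in $(0,\infty)^d$.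
   Context: For $\boldsymbol y=(y_1,\dots,y_d)\in(0,\infty)^d$ write $|\boldsymbol y|=\prod_{i=1}^d y_i$. The relation $\boldsymbol x\le\boldsymbol y$ is coordinatewise; $[\boldsymbol x,\boldsymbol y)=\prod_i[x_i,y_i)$ and $(\boldsymbol x,\boldsymbol y]=\prod_i(x_i,y_i]$. $\mathcal G_d$ is the set of all distribution functions of probability measures on $(0,\infty)^d$ (so $G(\boldsymbol 0)=0$). For $G\in\mathcal G_d$ put $$f_G(\boldsymbol x)=\int_{(0,\infty)^d}\frac1{|\boldsymbol v|}\mathbf 1_{(\boldsymbol 0,\boldsymbol v]}(\boldsymbol x)\,dG(\boldsymbol v)=\int_{\boldsymbol v\ge \boldsymbol x}\frac1{|\boldsymbol v|}\,dG(\boldsymbol v),\qquad \boldsymbol x\in(0,\infty)^d,$$ and $\mathcal F_{SMU}(d)=\{f_G:G\in\mathcal G_d\}$ (multivariate scale mixtures of uniform densities; $f=f_G$ is required to hold at every point). For $g:(0,\infty)^d\to[0,\infty)$ and $\boldsymbol x\le\boldsymbol y$ in $(0,\infty)^d$, the $g$-volume of $[\boldsymbol x,\boldsymbol y)$ is the signed vertex sum $$V_g[\boldsymbol x,\boldsymbol y)=\sum_{S\subseteq\{1,\dots,d\}}(-1)^{|S|}g(\boldsymbol u^S),\qquad u^S_i=x_i\ (i\in S),\ u^S_i=y_i\ (i\notin S).$$ If $f=f_G$ with $G\in\mathcal G_d$, the set function $[\boldsymbol x,\boldsymbol y)\mapsto(-1)^dV_f[\boldsymbol x,\boldsymbol y)$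 extends uniquely to a Borel measure on $(0,\infty)^d$, and $(-1)^dV_f(\boldsymbol u,\boldsymbol x]$ denotes the value of this extended measure on $(\boldsymbol u,\boldsymbol x]$ (it is this value, not the vertex sum of $f$ over $(\boldsymbol u,\boldsymbol x]$, that is meant). *)

(* Defs.v *)
From HB Require Import structures.
From mathcomp Require Import all_boot all_order all_algebra.
From mathcomp Require Import all_classical all_reals all_analysis.

Set Implicit Arguments.
Unset Strict Implicit.
Unset Printing Implicit Defensive.

Import Order.TTheory GRing.Theory Num.Theory.
Import numFieldNormedType.Exports.

Local Open Scope classical_set_scope.
Local Open Scope ring_scope.

(* The product sigma-algebra of n.-tuple (measurableTypeR R) is the Borel
   sigma-algebra of R^n; below, (0,oo)^d carries its trace. *)
Record orthant (R : realType) (d : nat) := Orthant {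
  orthant_val : d.-tuple (measurableTypeR R);
  orthant_val_gt0 : [forall i, 0 < (tnth orthant_val i : R)] }.

HB.instance Definition _ (R : realType) (d : nat) :=
  [isSub for @orthant_val R d].
HB.instance Definition _ (R : realType) (d : nat) :=
  [Choice of orthant R d by <:].

Definition coord (R : realType) (d : nat) (x : orthant R d) (i : 'I_d) : R :=
  tnth (orthant_val x) i.

Lemma coord_gt0 (R : realType) (d : nat) (x : orthant R d) i : 0 < coord x i.
Proof. exact: (forallP (orthant_val_gt0 x)). Qed.

Lemma mk_orthant_subproof (R : realType) (d : nat) (F : 'I_d -> R) :
  (forall i, 0 < F i) ->
  [forall i, 0 < (tnth ([tuple F i | i < d] : d.-tuple (measurableTypeR R)) i
                  : R)].
Proof. by move=> F0; apply/forallP => i; rewrite tnth_mktuple. Qed.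

Definition mk_orthant (R : realType) (d : nat) (F : 'I_d -> R)
    (F0 : forall i, 0 < F i) : orthant R d :=
  Orthant (mk_orthant_subproof F0).

Lemma coord_mk (R : realType) (d : nat) (F : 'I_d -> R)
    (F0 : forall i, 0 < F i) i : coord (mk_orthant F0) i = F i.
Proof. by rewrite /coord tnth_mktuple. Qed.

Lemma orthantP (R : realType) (d : nat) (x y : orthant R d) :
  coord x =1 coord y -> x = y.
Proof. by move=> xy; apply/val_inj/eq_from_tnth. Qed.

HB.instance Definition _ (R : realType) (d : nat) :=
  isPointed.Build (orthant R d) (mk_orthant (fun _ => ltr01)).

HB.instance Definition _ (R : realType) (d : nat) :=
  Measurable.copy (orthant R d)
    (g_sigma_algebra_preimageType (@orthant_val R d)).

(* Lebesgue measure on R^n, as the n-fold product of the one on R. *)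
Fixpoint lebesgue_tuple (R : realType) (n : nat) :
    set (n.-tuple (measurableTypeR R)) -> \bar R :=
  match n with
  | 0%N => dirac [tuple]
  | m.+1 =>
    pushforward (@lebesgue_measure R \x @lebesgue_tuple R m)%E
      (fun p : measurableTypeR R * m.-tuple (measurableTypeR R) =>
         [the m.+1.-tuple (measurableTypeR R) of p.1 :: p.2])
  end.

Section sigma_finite_measureP.
Context d (T : measurableType d) (R : realType).
Variable mu : {measure set T -> \bar R}.
Hypothesis mu_sigma_finite : sigma_finite setT mu.

Let nu : set T -> \bar R := mu.
HB.instance Definition _ := Measure.on nu.
HB.instance Definition _ :=
  Measure_isSigmaFinite.Build _ _ _ nu mu_sigma_finite.

Lemma sigma_finite_measureP :
  exists nu : {sigma_finite_measure set T -> \bar R},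
    nu = mu :> (set T -> \bar R).
Proof. by exists nu. Qed.

End sigma_finite_measureP.

Lemma product_measure_sigma_finite d1 d2 (T1 : measurableType d1)
    (T2 : measurableType d2) (R : realType)
    (m1 : {sigma_finite_measure set T1 -> \bar R})
    (m2 : {sigma_finite_measure set T2 -> \bar R}) :
  sigma_finite setT (m1 \x m2)%E.
Proof.
have /sigma_finiteP[F [TF ndF Foo]] := sigma_finiteT m1.
have /sigma_finiteP[G [TG ndG Goo]] := sigma_finiteT m2.
exists (fun n => F n `*` G n).
  rewrite -setXTT TF TG predeqE => -[x y]; split.
    move=> [/= [n _ Fnx] [k _ Gky]]; exists (maxn n k) => //; split.
    - by move: x Fnx; exact/subsetPset/ndF/leq_maxl.
    - by move: y Gky; exact/subsetPset/ndG/leq_maxr.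
  by move=> [n _ []/= ? ?]; split; exists n.
move=> k; have [? ?] := Foo k; have [? ?] := Goo k.
split; first exact: measurableX.
by rewrite product_measure1E// lte_mul_pinfty// ge0_fin_numE.
Qed.

Section lebesgue_tuple_measure.
Context (R : realType).
Local Notation RT := (measurableTypeR R).

Let f n (p : RT * n.-tuple RT) := [the n.+1.-tuple RT of p.1 :: p.2].
Let g n (t : n.+1.-tuple RT) : RT * n.-tuple RT :=
  (thead t, [tuple of behead t]).

Let mf n : measurable_fun setT (@f n).
Proof. exact: measurable_cons. Qed.

Let mg n : measurable_fun setT (@g n).
Proof.
by apply/measurable_fun_pairP; split; [exact: measurable_tnth|
  exact: measurable_behead].
Qed.

Let fK n : cancel (@f n) (@g n).
Proof. by move=> [x t]; congr (_, _); apply/val_inj. Qed.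

Let gK n : cancel (@g n) (@f n).
Proof. by move=> t; rewrite [RHS](tuple_eta t); apply/val_inj. Qed.

Let lebesgue_tuple_sfm n :
  exists mu : {sigma_finite_measure set (n.-tuple RT) -> \bar R},
    mu = @lebesgue_tuple R n :> (set _ -> _).
Proof.
elim: n => [|n [mu IH]] /=.
  apply: (sigma_finite_measureP (mu := @dirac _ (0.-tuple RT) [tuple] R)).
  exists (fun _ => setT); first by rewrite bigcup_const.
  by move=> i; split => //=; rewrite diracE in_setT ltry.
rewrite -IH.
pose pm : {measure set (RT * n.-tuple RT)%type -> \bar R} :=
  (@lebesgue_measure R \x mu)%E.
apply: (sigma_finite_measureP
  (mu := measure_function_pushforward__canonical__measure_function_Measure
    pm (@mf n))).
have [F FT Foo] : sigma_finite setT pm.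
  exact: (@product_measure_sigma_finite _ _ _ _ R (@lebesgue_measure R) mu).
exists (fun k => @g n @^-1` F k).
  by rewrite -preimage_bigcup -FT preimage_setT.
move=> k; have [mF Fk] := Foo k; split.
  by rewrite -[X in measurable X]setTI; exact: mg.
rewrite /= /pushforward (_ : @f n @^-1` (@g n @^-1` F k) = F k)//.
by apply/seteqP; split => x /=; rewrite fK.
Qed.

Lemma lebesgue_tupleS n (A : set (n.+1.-tuple RT)) :
  lebesgue_tuple A = (@lebesgue_measure R \x @lebesgue_tuple R n)%E
    [set p : RT * n.-tuple RT | A [the n.+1.-tuple RT of p.1 :: p.2]].
Proof. by []. Qed.

Let lebesgue_tuple0 n : @lebesgue_tuple R n set0 = 0%E.
Proof. by have [mu <-] := lebesgue_tuple_sfm n; exact: measure0. Qed.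

Let lebesgue_tuple_ge0 n A : (0 <= @lebesgue_tuple R n A)%E.
Proof. by have [mu <-] := lebesgue_tuple_sfm n; exact: measure_ge0. Qed.

Let lebesgue_tuple_sigma_additive n :
  semi_sigma_additive (@lebesgue_tuple R n).
Proof.
by have [mu <-] := lebesgue_tuple_sfm n; exact: measure_semi_sigma_additive.
Qed.

HB.instance Definition _ n := isMeasure.Build _ _ _ (@lebesgue_tuple R n)
  (@lebesgue_tuple0 n) (@lebesgue_tuple_ge0 n)
  (@lebesgue_tuple_sigma_additive n).

Let lebesgue_tuple_sigma_finite n : sigma_finite setT (@lebesgue_tuple R n).
Proof. by have [mu <-] := lebesgue_tuple_sfm n; exact: sigma_finiteT. Qed.

HB.instance Definition _ n := Measure_isSigmaFinite.Build _ _ _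
  (@lebesgue_tuple R n) (@lebesgue_tuple_sigma_finite n).

Lemma lebesgue_tuple_box n (a : 'I_n -> set RT) :
  (forall i, measurable (a i)) ->
  lebesgue_tuple [set t : n.-tuple RT | forall i, a i (tnth t i)] =
  (\prod_(i < n) @lebesgue_measure R (a i))%E.
Proof.
elim: n a => [|n IH] a ma.
  rewrite big_ord0 /= diracE mem_set//= => -[]//.
rewrite lebesgue_tupleS big_ord_recl -IH; last by move=> i; exact: ma.
rewrite -product_measure1E//.
  congr (_ _); apply/seteqP; split => -[x t] /=.
    move=> H; split; first by have := H ord0.
    by move=> i; have := H (lift ord0 i); rewrite tnthS.
  move=> [ax at_] i; have [->//|i0] := eqVneq i ord0.
  by case: (unliftP ord0 i) i0 => [j ->|->]; rewrite ?eqxx// tnthS.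
rewrite (_ : [set t | _] =
  \bigcap_(i in [set: 'I_n]) (fun t : n.-tuple RT => tnth t i) @^-1`
    a (lift ord0 i)); last first.
  by apply/seteqP; split => [t H i _|t H i]; exact: H.
apply: fin_bigcap_measurable => // i _; rewrite -[X in measurable X]setTI.
exact: measurable_tnth.
Qed.

End lebesgue_tuple_measure.

(* Lebesgue measure on (0,oo)^d. *)
Definition lebesgue_orthant (R : realType) (d : nat) :
    set (orthant R d) -> \bar R :=
  fun A => lebesgue_tuple (@orthant_val R d @` A).

Section lebesgue_orthant_measure.
Context (R : realType) (d : nat).
Local Notation RT := (measurableTypeR R).

Lemma measurable_orthant_val : measurable_fun setT (@orthant_val R d).
Proof. by move=> _ B mB; exists B. Qed.

Lemma measurable_coord i :
  measurable_fun setT (fun x : orthant R d => coord x i).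
Proof.
apply: (@measurableT_comp _ _ _ _ _ _ (fun x : d.-tuple RT => tnth x i)).
  exact: measurable_tnth.
exact: measurable_orthant_val.
Qed.

Let image_orthant (B : set (d.-tuple RT)) :
  @orthant_val R d @` (@orthant_val R d @^-1` B) =
  B `&` [set t : d.-tuple RT | forall i, `]0%R, +oo[%classic (tnth t i : R)].
Proof.
apply/seteqP; split => [_ [x Bx <-]|t [Bt t0]].
  by split => // i; rewrite /= in_itv/= andbT; exact: (coord_gt0 x i).
have t0' : [forall i, 0 < (tnth t i : R)].
  by apply/forallP => i; have := t0 i; rewrite /= in_itv/= andbT.
by exists (Orthant t0').
Qed.

Lemma measurable_image_orthant_val (A : set (orthant R d)) :
  measurable A -> measurable (@orthant_val R d @` A).
Proof.
move=> [B mB]; rewrite setTI => <-; rewrite image_orthant.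
apply: measurableI => //.
rewrite (_ : [set t | _] =
  \bigcap_(i in [set: 'I_d]) (fun t : d.-tuple RT => tnth t i) @^-1`
    `]0%R, +oo[%classic); last first.
  by apply/seteqP; split => [t H i _|t H i]; exact: H.
apply: fin_bigcap_measurable => // i _; rewrite -[X in measurable X]setTI.
exact: measurable_tnth.
Qed.

Let orthant_val_inj : injective (@orthant_val R d).
Proof. exact: val_inj. Qed.

Let lebesgue_orthant0 : @lebesgue_orthant R d set0 = 0%E.
Proof. by rewrite /lebesgue_orthant image_set0 measure0. Qed.

Let lebesgue_orthant_ge0 A : (0 <= @lebesgue_orthant R d A)%E.
Proof. exact: measure_ge0. Qed.

Let lebesgue_orthant_sigma_additive :
  semi_sigma_additive (@lebesgue_orthant R d).
Proof.
move=> F mF tF mUF; rewrite /lebesgue_orthant image_bigcup.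
apply: (@measure_semi_sigma_additive _ _ _ (@lebesgue_tuple R d)).
- by move=> i; exact: measurable_image_orthant_val.
- move=> i j _ _ [_ [[x Fx <-] [y Fy]]] /orthant_val_inj yx.
  by apply: tF => //; exists x; split => //; rewrite -yx.
- by rewrite -image_bigcup; exact: measurable_image_orthant_val.
Qed.

HB.instance Definition _ := isMeasure.Build _ _ _ (@lebesgue_orthant R d)
  lebesgue_orthant0 lebesgue_orthant_ge0 lebesgue_orthant_sigma_additive.

Let lebesgue_orthant_sigma_finite :
  sigma_finite setT (@lebesgue_orthant R d).
Proof.
have [F FT Foo] := sigma_finiteT (@lebesgue_tuple R d).
exists (fun k => @orthant_val R d @^-1` F k).
  by rewrite -preimage_bigcup -FT preimage_setT.
move=> k; have [mF Fk] := Foo k.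
have mP : measurable (@orthant_val R d @^-1` F k).
  by rewrite -[X in measurable X]setTI; exact: measurable_orthant_val.
split => //; apply: le_lt_trans Fk.
apply: le_measure; rewrite ?inE//; first exact: measurable_image_orthant_val.
exact: image_preimage_subset.
Qed.

HB.instance Definition _ := Measure_isSigmaFinite.Build _ _ _
  (@lebesgue_orthant R d) lebesgue_orthant_sigma_finite.

End lebesgue_orthant_measure.

Lemma lebesgue_orthant_box (R : realType) (d : nat) (x y : orthant R d) :
  (forall i, coord x i <= coord y i) ->
  lebesgue_orthant [set z : orthant R d |
    forall i, coord x i <= coord z i < coord y i] =
  (\prod_(i < d) (coord y i - coord x i))%:E.
Proof.
move=> xy; rewrite /lebesgue_orthant.
pose a i : set (measurableTypeR R) := `[coord x i, coord y i[%classic.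
rewrite (_ : _ @` _ = [set t | forall i, a i (tnth t i)]); last first.
  apply/seteqP; split => [_ [z zxy <-] i|t ta].
    by rewrite /a/= in_itv/=; exact: zxy.
  have t0 : [forall i, 0 < (tnth t i : R)].
    apply/forallP => i; have := ta i; rewrite /a/= in_itv/= => /andP[+ _].
    by apply: lt_le_trans; exact: coord_gt0.
  exists (Orthant t0) => //= i; have := ta i; by rewrite /a/= in_itv.
rewrite lebesgue_tuple_box => [|i]; last exact: measurable_itv.
rewrite -prodEFin; apply: eq_bigr => i _.
rewrite /a lebesgue_measure_itv/= lte_fin lt_neqAle xy andbT.
by case: eqVneq => [->|_]; rewrite ?subrr// EFinB.
Qed.

Section scale_mixtures.
Context (R : realType) (d : nat).
Implicit Types (f g G : orthant R d -> R) (x y u v z : orthant R d).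

Definition vol x : R := \prod_(i < d) coord x i.

Definition ole x y : Prop := forall i, coord x i <= coord y i.

Definition box_co x y : set (orthant R d) :=
  [set z | forall i, coord x i <= coord z i < coord y i].

Definition box_oc x y : set (orthant R d) :=
  [set z | forall i, coord x i < coord z i <= coord y i].

Definition dist_fun (P : probability (orthant R d) R) : orthant R d -> R :=
  fun x => fine (P [set v | ole v x]).

Definition distribution_functions : set (orthant R d -> R) :=
  [set G | exists P : probability (orthant R d) R, dist_fun P = G].

(* dG, for G in distribution_functions: it is unique on Borel sets, the only
   ones seen by integrals.  The Dirac mass is a default for all other G. *)
Definition law G : probability (orthant R d) R :=
  xget (dirac point : probability (orthant R d) R) [set P | dist_fun P = G].

(* The integrand is at most (vol x)^-1, so the integral is finite. *)
Definition smu_density G : orthant R d -> R :=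
  fun x => \int[law G]_(v in [set v | ole x v]) (vol v)^-1.

Definition smu_densities : set (orthant R d -> R) :=
  smu_density @` distribution_functions.

Lemma vertex_subproof (S : {set 'I_d}) x y (i : 'I_d) :
  0 < (if i \in S then coord x i else coord y i).
Proof. by case: ifP => _; exact: coord_gt0. Qed.

Definition vertex (S : {set 'I_d}) x y : orthant R d :=
  mk_orthant (vertex_subproof S x y).

Definition volume g x y : R :=
  \sum_(S : {set 'I_d}) (-1) ^+ #|S| * g (vertex S x y).

(* Such a mu is unique on Borel sets: the boxes form a pi-system generating the
   Borel sets, and finite-mass boxes cover (0,oo)^d. *)
Definition extends_volume f (mu : {measure set (orthant R d) -> \bar R}) :=
  forall x y, ole x y -> mu (box_co x y) = ((-1) ^+ d * volume f x y)%:E.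

Definition upper_semicontinuous f :=
  forall x (a : R), f x < a ->
  exists2 e : R, 0 < e &
    forall y, (forall i, `|coord y i - coord x i| < e) -> f y < a.

Definition probability_density f :=
  [/\ forall x, 0 <= f x, measurable_fun setT f &
      (\int[@lebesgue_orthant R d]_x (f x)%:E = 1)%E].

Definition vanishes_at_infinity_coordinatewise f :=
  forall x (i : 'I_d) (e : R), 0 < e ->
  exists M : R, forall y, (forall j, j != i -> coord y j = coord x j) ->
    M < coord y i -> `|f y| < e.

End scale_mixtures.

(* Main.v *)
From Pilot Require Import Defs.
From HB Require Import structures.
From mathcomp Require Import all_boot all_order all_algebra.
From mathcomp Require Import all_classical all_reals all_analysis.
From mathcomp Require Import measurable_realfun.
From mathcomp Require Import lra ring.
(* The linear-algebra imports rebind coord, meant here as a coordinate in the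
   orthant. *)
Import Pilot.Defs.

Set Implicit Arguments.
Unset Strict Implicit.
Unset Printing Implicit Defensive.

Import Order.TTheory GRing.Theory Num.Theory.
Import numFieldNormedType.Exports.

Local Open Scope classical_set_scope.
Local Open Scope ring_scope.

(** Let mu be the measure with density 1/|v| with respect to the law of G.  Then
    f_G(x) is the mass that mu gives to the upper orthant [v >= x], in other
    words f_G is the survival function of mu.  Inclusion-exclusion turns the
    signed vertex sum of f_G over a box into the mu-mass of the box
    ([survival_volume]), so f_G has the sign property of (b).  Since the box
    below v has Lebesgue measure |v|, which cancels the density 1/|v|, Tonelli's
    theorem gives back G(x) as the integral of mu(u, x] over u
    ([integral_inverse_volume_measure]).  Upper orthants form a pi-system that
    generates the Borel sets, so f_G determines mu, hence G
    ([smu_density_inj]).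

    For the converse in (b) a measure mu has to be built from its candidate
    survival function f.  Sending coordinates to infinity one at a time, the
    sign condition on f passes to all lower-dimensional differences
    ([survival_increment_ge0]).  After the change of variables w = 1/x, f becomes
    a function F with nonnegative increments that vanishes when a coordinate
    vanishes and is right-continuous (this is where upper semi-continuity
    enters); capping the coordinates at a level c makes it the distribution
    function of a finite measure on the cube [0, c]^d.

    That measure is the image of Lebesgue measure on the interval [0, F(c,...,c))
    under an explicit map.  Cut the cube repeatedly into halves, and the interval
    along with it, giving each cell a slot whose length is the F-mass of the cell.
    A number u lies in a decreasing sequence of slots, and the corresponding cells
    shrink to a point T(u).  Counting slots of small cells gives
    |{u : T(u) <= x}| = F(x) up to one mesh size, and right-continuity removes the
    error ([lebesgue_bisection_point]).

    The measures obtained for c = 1, 2, 3, ... are glued along the shells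
    [v >= 1/(n+1)] \ [v >= 1/n], where the masses telescope to f
    ([glue_measures]).  Finally |v| dmu(v) is a probability measure, because by
    Tonelli its mass is the integral of f; it is the mixing law
    ([smu_density_of_survival]). *)

(** * Measurability of coordinatewise conditions and of inversion *)

Lemma measurable_forall_ord disp (T : measurableType disp) (n : nat)
    (b : 'I_n -> T -> bool) :
  (forall i, measurable_fun setT (b i)) -> measurable [set t | forall i, b i t].
Proof.
move=> mb; rewrite (_ : [set t | _] =
    \bigcap_(i in [set: 'I_n]) (b i @^-1` [set true])).
  apply: fin_bigcap_measurable => // i _; rewrite -[X in measurable X]setTI.
  exact: mb.
by apply/seteqP; split => t /= H; [move=> i _; exact: H|move=> i; exact: H].
Qed.

Lemma measurable_invr {R : realType} : measurable_fun setT (@GRing.inv R).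
Proof.
rewrite (_ : GRing.inv =
  fun r => if 0 <= r then r `^ (-1) else - ((- r) `^ (-1))).
  apply: measurable_fun_ifT; last 2 first.
  - exact: measurable_powR.
  - apply: measurableT_comp => //.
    exact: (measurableT_comp (measurable_powR _)).
  by apply: measurable_fun_ler.
apply/funext => r; case: (leP 0 r) => r0; first by rewrite powR_inv1.
by rewrite powR_inv1 ?oppr_ge0 ?ltW// invrN opprK.
Qed.

(** * Iterated differences *)

Section increments.
Context {R : realType} {d : nat}.
Implicit Types (F : ('I_d -> R) -> R) (p q w : 'I_d -> R) (A S : {set 'I_d}).

Definition set_coord q (i : 'I_d) (c : R) : 'I_d -> R :=
  fun j => if j == i then c else q j.

(** The vertices of the box spanned by [p] and [q]. *)
Definition replace S p q : 'I_d -> R := fun i => if i \in S then p i else q i.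

(** Iterated difference of [F] from [p] to [q] in the directions of [A], the other
    coordinates being kept at [q].  The order of [p] and [q] is left free: a
    distribution function is increasing in this sense for [p <= q], a survival
    function for [p >= q]. *)
Definition increment A F p q : R :=
  \sum_(S : {set 'I_d} | S \subset A) (-1) ^+ #|S| * F (replace S p q).

Lemma eq_increment A F F' p p' q q' :
  (forall S, S \subset A -> F (replace S p q) = F' (replace S p' q')) ->
  increment A F p q = increment A F' p' q'.
Proof. by move=> FF'; apply: eq_bigr => S SA; rewrite FF'. Qed.

Lemma eq_increment_lower A F p p' q : {in A, p =1 p'} ->
  increment A F p q = increment A F p' q.
Proof.
move=> pp'; apply: eq_increment => S SA; congr F; apply/funext => i.
by rewrite /replace; case: ifPn => // iS; rewrite pp' // (fintype.subsetP SA).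
Qed.

Lemma set_coordK q i : set_coord q i (q i) = q.
Proof. by apply/funext => j; rewrite /set_coord; case: eqP => [->|]. Qed.

Lemma set_coord_eq q i c : set_coord q i c i = c.
Proof. by rewrite /set_coord eqxx. Qed.

Lemma set_coord2 q i a b : set_coord (set_coord q i a) i b = set_coord q i b.
Proof. by apply/funext => j; rewrite /set_coord; case: eqP. Qed.

Lemma increment0 F p q : increment finset.set0 F p q = F q.
Proof.
rewrite /increment (big_pred1 finset.set0) => [|S]; last first.
  by rewrite finset.subset0.
rewrite cards0 expr0 mul1r; congr F; apply/funext => i.
by rewrite /replace finset.inE.
Qed.

(** One direction is split off by grouping the vertices according to whether they
    use [p i] or [q i]. *)
Lemma incrementU1 i A F p q : i \notin A ->
  increment (i |: A)%SET F p q =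
  increment A F p q - increment A F p (set_coord q i (p i)).
Proof.
move=> iA; rewrite /increment (bigID (fun S => i \in S))/= addrC; congr (_ + _).
  apply: eq_bigl => S; apply/andP/idP => [[SiA iS]|SA].
    by rewrite -(setU1K iA) finset.subsetD1 SiA.
  split; first by rewrite (fintype.subset_trans SA)// subsetU1.
  by apply: contra iA => /(fintype.subsetP SA).
rewrite -sumrN (reindex_onto (fun S => i |: S)%SET (fun S => S :\ i)%SET)/=.
  apply: eq_big => [S|S /andP[_ /eqP SE]].
    rewrite setU11 andbT; apply/andP/idP => [[iSiA /eqP SE]|SA].
      by have := finset.setSD [set i]%SET iSiA; rewrite SE setU1K.
    split; first exact: finset.setUS.
    by rewrite setU1K//; apply: contra iA => /(fintype.subsetP SA).
  have iS : i \notin S by rewrite -SE !finset.inE eqxx.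
  rewrite cardsU1 iS exprS mulN1r mulNr; congr (- (_ * F _)).
  apply/funext => j; rewrite /replace /set_coord !finset.inE.
  by case: eqP => [->|]//=; rewrite (negbTE iS).
by move=> S /andP[_ iS]; rewrite finset.setD1K.
Qed.

Lemma incrementD1 i A F p q : i \in A ->
  increment A F p q =
  increment (A :\ i)%SET F p q - increment (A :\ i)%SET F p (set_coord q i (p i)).
Proof.
by move=> iA; rewrite -{1}(finset.setD1K iA) incrementU1// finset.setD11.
Qed.

Lemma increment_degenerate i A F p q : i \in A -> p i = q i ->
  increment A F p q = 0.
Proof. by move=> iA piqi; rewrite (incrementD1 _ _ _ iA) piqi set_coordK subrr. Qed.

(** The mass of a box is the sum of the masses of the two pieces cut off by a
    hyperplane. *)
Lemma increment_split i c A F p q : i \in A ->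
  increment A F p q =
  increment A F p (set_coord q i c) + increment A F (set_coord p i c) q.
Proof.
move=> iA; rewrite !(incrementD1 _ _ _ iA) !set_coord2.
have E : {in (A :\ i)%SET, set_coord p i c =1 p}.
  by move=> j; rewrite !finset.inE /set_coord => /andP[/negbTE ->].
rewrite !(eq_increment_lower _ _ E) set_coord_eq.
by rewrite addrC [RHS]addrC addrA subrK addrC.
Qed.

Lemma increment_comp A F (h : 'I_d -> R -> R) p q :
  increment A (fun w => F (fun i => h i (w i))) p q =
  increment A F (fun i => h i (p i)) (fun i => h i (q i)).
Proof.
apply: eq_increment => S SA; congr F; apply/funext => i.
by rewrite /replace; case: ifP.
Qed.

End increments.

Section nonneg_increments.
Context {R : realType} {d : nat}.
Implicit Types (F : ('I_d -> R) -> R) (p q x : 'I_d -> R) (A : {set 'I_d}).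

(** Differences in all sets of directions are required to be nonnegative, not only
    the full ones: with a single direction this contains monotonicity. *)
Definition nonneg_increments F := forall A p q, (forall i, p i <= q i) ->
  0 <= increment A F p q.

Lemma nonneg_increments_mono F p q : nonneg_increments F ->
  (forall i, p i <= q i) -> F p <= F q.
Proof.
move=> F0 pq.
suff H (s : seq 'I_d) : F (fun i => if i \in s then p i else q i) <= F q.
  have := H (fintype.enum 'I_d); congr (F _ <= F q).
  by apply/funext => i; rewrite mem_enum.
elim: s => [|i s IH]; first by under [X in F X]funext do rewrite in_nil.
apply: le_trans IH; set w := (X in _ <= F X).
have := F0 [set i]%SET p w; rewrite -(finset.setU0 [set i]%SET).
rewrite incrementU1 ?finset.inE// !increment0 subr_ge0.
rewrite (_ : set_coord w i (p i) = fun j => if j \in i :: s then p j else q j).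
  by apply => j; rewrite /w; case: ifP.
by apply/funext => j; rewrite /set_coord/= inE; case: eqP => [->|].
Qed.

Let increment_cap_step F p q i c : nonneg_increments F ->
  (forall j, p j <= q j) ->
  increment finset.setT F (set_coord p i (Num.min (p i) c))
    (set_coord q i (Num.min (q i) c)) <= increment finset.setT F p q.
Proof.
move=> F0 pq; have [qc|cq] := leP (q i) c.
  by rewrite set_coordK min_l ?set_coordK// (le_trans (pq i)).
have [pc|cp] := leP (p i) c.
  rewrite set_coordK (@increment_split _ _ i c _ _ p q) ?finset.inE//.
  rewrite lerDl F0// => j; rewrite /set_coord; case: eqP => // ->.
  exact: ltW.
rewrite (@increment_degenerate _ _ i) ?finset.inE ?set_coord_eq//.
exact: F0.
Qed.

(** Intersecting a box with the orthant below [x] does not increase its mass: the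
    coordinates are capped one at a time, and each step either changes nothing,
    removes a half of the box, or collapses the box. *)
Lemma increment_cap F p q x : nonneg_increments F ->
  (forall i, p i <= q i) ->
  increment finset.setT F (fun i => Num.min (p i) (x i))
    (fun i => Num.min (q i) (x i)) <= increment finset.setT F p q.
Proof.
move=> F0 pq; pose cap (s : seq 'I_d) (w : 'I_d -> R) :=
  fun i => if i \in s then Num.min (w i) (x i) else w i.
have capE w : cap (fintype.enum 'I_d) w = fun i => Num.min (w i) (x i).
  by apply/funext => i; rewrite /cap mem_enum.
rewrite -!capE; elim: (fintype.enum 'I_d) => [//|i s IH].
apply: le_trans IH.
have capS w : cap (i :: s) w =
    set_coord (cap s w) i (Num.min (cap s w i) (x i)).
  apply/funext => j; rewrite /set_coord /cap inE; case: eqP => [->|//] /=.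
  by case: ifP => // _; rewrite -minA minxx.
rewrite !capS; apply: increment_cap_step => // j; rewrite /cap.
by case: ifP => _; rewrite ?le_min2 ?pq.
Qed.

End nonneg_increments.

(** * Measures from distribution functions, by bisection *)

Section bisection.
Context {R : realType} {d : nat}.
Variable F : ('I_d -> R) -> R.
Hypothesis F0 : nonneg_increments F.
Implicit Types (p q x : 'I_d -> R) (t u : R) (l : seq 'I_d).

Local Notation mass p q := (increment finset.setT F p q).
Local Notation leb := (@lebesgue_measure R).

(* A cell (p, q, t) is the box (p, q] together with the left end t of its slot,
   the interval [t, t + mass p q).  Keeping absolute positions of the slots makes
   translations of Lebesgue measure unnecessary. *)
Let cell_type : Type := (('I_d -> R) * ('I_d -> R) * R)%type.
Implicit Types s : cell_type.

Definition lower s := s.1.1.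
Definition upper s := s.1.2.
Definition offset s := s.2.

Definition midpoint s (i : 'I_d) := (lower s i + upper s i) / 2.

Definition left_half s i : cell_type :=
  (lower s, set_coord (upper s) i (midpoint s i), offset s).

Definition right_half s i : cell_type :=
  (set_coord (lower s) i (midpoint s i), upper s,
   offset s + mass (lower s) (set_coord (upper s) i (midpoint s i))).

Definition bisect u s i : cell_type :=
  if u < offset (right_half s i) then left_half s i else right_half s i.

Definition cell_at u s l : cell_type := foldl (bisect u) s l.

Definition ordered_cell s := forall i, lower s i <= upper s i.

Let midpoint_between s i : ordered_cell s ->
  lower s i <= midpoint s i <= upper s i.
Proof. by move=> /(_ i) ?; rewrite /midpoint; apply/andP; split; lra. Qed.

Lemma ordered_left_half s i : ordered_cell s -> ordered_cell (left_half s i).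
Proof.
move=> os j; rewrite /left_half/lower/upper/= /set_coord; case: eqP => [->|_].
  by have /andP[] := midpoint_between i os.
exact: os.
Qed.

Lemma ordered_right_half s i : ordered_cell s -> ordered_cell (right_half s i).
Proof.
move=> os j; rewrite /right_half/lower/upper/= /set_coord; case: eqP => [->|_].
  by have /andP[] := midpoint_between i os.
exact: os.
Qed.

Lemma ordered_cell_at u s l : ordered_cell s -> ordered_cell (cell_at u s l).
Proof.
elim: l s => [|i l IH] s os //=; apply: IH; rewrite /bisect.
by case: ifP => _; [exact: ordered_left_half|exact: ordered_right_half].
Qed.

Lemma cell_at_nested u s l i : ordered_cell s ->
  lower s i <= lower (cell_at u s l) i /\ upper (cell_at u s l) i <= upper s i.
Proof.
elim: l s => [|j l IH] s os //=; rewrite /bisect.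
have /andP[lm mu] := midpoint_between j os.
case: ifP => _.
  have [h1 h2] := IH _ (ordered_left_half j os); split => //.
  apply: le_trans h2 _; rewrite /left_half/upper/= /set_coord.
  by case: eqP => // ->.
have [h1 h2] := IH _ (ordered_right_half j os); split => //.
apply: le_trans h1; rewrite /right_half/lower/= /set_coord.
by case: eqP => // ->.
Qed.

Lemma left_half_width s i j :
  upper (left_half s i) j - lower (left_half s i) j =
  (upper s j - lower s j) / 2 ^+ (i == j).
Proof.
rewrite /left_half/upper/lower/= /set_coord eq_sym.
case: eqP => [->|_]; rewrite ?expr0 ?expr1 ?divr1// /midpoint/upper/lower.
by field.
Qed.

Lemma right_half_width s i j :
  upper (right_half s i) j - lower (right_half s i) j =
  (upper s j - lower s j) / 2 ^+ (i == j).
Proof.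
rewrite /right_half/upper/lower/= /set_coord eq_sym.
case: eqP => [->|_]; rewrite ?expr0 ?expr1 ?divr1// /midpoint/upper/lower.
by field.
Qed.

Lemma cell_at_width u s l i :
  upper (cell_at u s l) i - lower (cell_at u s l) i =
  (upper s i - lower s i) / 2 ^+ count_mem i l.
Proof.
elim: l s => [|j l IH] s /=; first by rewrite expr0 divr1.
rewrite IH exprD invfM mulrA /bisect.
by case: ifP => _; rewrite ?left_half_width ?right_half_width.
Qed.

Lemma measurable_upper_cell_at s l i :
  measurable_fun setT (fun u => upper (cell_at u s l) i).
Proof.
elim: l s => [|j l IH] s /=; first exact: measurable_cst.
pose a := offset (right_half s j).
rewrite [X in measurable_fun _ X](_ : _ = fun u => if u < a
  then upper (cell_at u (left_half s j) l) i
  else upper (cell_at u (right_half s j) l) i); last first.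
  by apply/funext => u; rewrite /bisect -/a; case: ifP.
apply: measurable_fun_ifT; [|exact: IH|exact: IH].
by apply: measurable_fun_ltr; [exact: measurable_id|exact: measurable_cst].
Qed.

(** The numbers of the slot of [s] that the bisections along [l] lead to a
    subcell contained in the orthant below [x]. *)
Definition slots s l x : set R :=
  [set u | offset s <= u < offset s + mass (lower s) (upper s) /\
           forall i, upper (cell_at u s l) i <= x i].

Lemma measurable_slots s l x : measurable (slots s l x).
Proof.
rewrite (_ : slots s l x =
  `[offset s, offset s + mass (lower s) (upper s)[%classic `&`
  [set u | forall i, upper (cell_at u s l) i <= x i]); last first.
  by apply/seteqP; split => u /=; rewrite in_itv.
apply: measurableI; first exact: measurable_itv.
apply: measurable_forall_ord => i.
apply: measurable_fun_ler; last exact: measurable_cst.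
exact: measurable_upper_cell_at.
Qed.

Lemma mass_halves s i : mass (lower s) (upper s) =
  mass (lower (left_half s i)) (upper (left_half s i)) +
  mass (lower (right_half s i)) (upper (right_half s i)).
Proof. by apply: increment_split; rewrite finset.inE. Qed.

Lemma lebesgue_slots_cons s i l x : ordered_cell s ->
  leb (slots s (i :: l) x) =
  (leb (slots (left_half s i) l x) + leb (slots (right_half s i) l x))%E.
Proof.
move=> os; have m1 : 0 <= mass (lower (left_half s i)) (upper (left_half s i)).
  exact/F0/ordered_left_half.
have m2 : 0 <= mass (lower (right_half s i)) (upper (right_half s i)).
  exact/F0/ordered_right_half.
rewrite -measureU; [|exact: measurable_slots|exact: measurable_slots|].
  congr (leb _); apply/seteqP; split => u; rewrite /slots /= (mass_halves s i).
    move=> [/andP[h1 h2]]; rewrite /bisect; case: ifPn => [u1 H|+ H].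
      by left; split => //; apply/andP; split.
    rewrite -leNgt => u1; right; split => //.
    by rewrite u1/= /right_half /offset/= -addrA.
  move=> [|] [/andP[h1 h2] H]; split => //.
  - by rewrite h1/= (lt_le_trans h2)// addrA lerDl.
  - by move=> j; rewrite /bisect h2.
  - by rewrite (le_trans _ h1) ?lerDl//= addrA.
  - by move=> j; rewrite /bisect ltNge h1.
rewrite -subset0 => u [[/andP[_ h1] _] [/andP[h2 _] _]].
by have := lt_le_trans h1 h2; rewrite ltxx.
Qed.

Local Notation cap x p := (fun i => Num.min (p i) (x i)).

Lemma capped_mass_halves s i x : mass (cap x (lower s)) (cap x (upper s)) =
  mass (cap x (lower (left_half s i))) (cap x (upper (left_half s i))) +
  mass (cap x (lower (right_half s i))) (cap x (upper (right_half s i))).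
Proof.
rewrite -!(increment_comp _ F (fun i w => Num.min w (x i))).
by apply: increment_split; rewrite finset.inE.
Qed.

Lemma lebesgue_slots0 s x : ordered_cell s -> (forall i, upper s i <= x i) ->
  leb (slots s [::] x) = (mass (lower s) (upper s))%:E.
Proof.
move=> os sx; rewrite (_ : slots _ _ _ =
    `[offset s, offset s + mass (lower s) (upper s)[%classic); last first.
  apply/seteqP; split => u; rewrite /slots /= in_itv/=; first by case.
  by move=> ?; split.
rewrite lebesgue_measure_itv/= lte_fin ltrDl -EFinD addrAC subrr add0r.
by have := F0 finset.setT os; rewrite le_eqVlt; case: ltgtP => // <-.
Qed.

(** By induction on the bisections it is enough to look at one undivided cell: its
    slot counts only if the cell lies below [x], and then capping changes
    nothing. *)
Lemma lebesgue_slots_le s l x : ordered_cell s ->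
  (leb (slots s l x) <= (mass (cap x (lower s)) (cap x (upper s)))%:E)%E.
Proof.
elim: l s => [|i l IH] s os; last first.
  rewrite lebesgue_slots_cons// (capped_mass_halves s i) EFinD.
  by apply: leeD; apply: IH; [exact: ordered_left_half|exact: ordered_right_half].
have [sx|/existsNP[i /negP]] := pselect (forall i, upper s i <= x i).
  rewrite lebesgue_slots0// (_ : cap x (lower s) = lower s).
    by rewrite (_ : cap x (upper s) = upper s)//; apply/funext => i; rewrite min_l.
  by apply/funext => i; rewrite min_l// (le_trans (os i)).
rewrite -ltNge => xs; rewrite (_ : slots _ _ _ = set0).
  by rewrite measure0 lee_fin F0// => j; rewrite le_min2.
by rewrite -subset0 => u [_ /(_ i)/=]; rewrite leNgt xs.
Qed.

(** Same induction as for [lebesgue_slots_le].  A cell of width at most [e] that is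
    not below [x + e] lies beyond [x] in some direction, where capping makes it
    degenerate. *)
Lemma lebesgue_slots_ge s l x (e : R) : ordered_cell s ->
  (forall i, (upper s i - lower s i) / 2 ^+ count_mem i l <= e) ->
  ((mass (cap x (lower s)) (cap x (upper s)))%:E <=
   leb (slots s l (fun i => x i + e)%R))%E.
Proof.
elim: l s => [|i l IH] s os we; last first.
  rewrite lebesgue_slots_cons// (capped_mass_halves s i) EFinD.
  apply: leeD; apply: IH; [exact: ordered_left_half| |exact: ordered_right_half|].
  - by move=> j; rewrite left_half_width -mulrA -invfM -exprD; exact: we.
  - by move=> j; rewrite right_half_width -mulrA -invfM -exprD; exact: we.
have [sx|/existsNP[i /negP]] := pselect (forall i, upper s i <= x i + e).
  by rewrite lebesgue_slots0// lee_fin increment_cap.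
rewrite -ltNge => xs; have := we i; rewrite expr0 divr1 => wi.
rewrite (@increment_degenerate _ _ i) ?finset.inE//.
have h := os i; rewrite !min_r//; [by apply/ltW; lra|lra].
Qed.

End bisection.

Section bisection_limit.
Context {R : realType} {d : nat}.
Variables (F : ('I_d -> R) -> R) (a b : 'I_d -> R).
Hypotheses (F0 : nonneg_increments F) (ab : forall i, a i <= b i).
Hypothesis F_vanish : forall w i, w i <= a i -> F w = 0.
Hypothesis F_cap : forall w, F w = F (fun i => Num.min (w i) (b i)).
Implicit Types (x : 'I_d -> R) (u : R) (i : 'I_d).

Local Notation leb := (@lebesgue_measure R).
Local Notation root := (a, b, 0 : R).

(** Each round bisects once in every direction, so that [n] rounds divide all
    widths by [2 ^ n]. *)
Fixpoint rounds (n : nat) : seq 'I_d :=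
  if n is m.+1 then rounds m ++ fintype.enum 'I_d else [::].

Lemma roundsD m n : rounds (m + n) = rounds m ++ rounds n.
Proof.
by elim: n => [|n IH]; rewrite ?addn0 ?cats0// addnS /= IH catA.
Qed.

Lemma count_rounds n i : count_mem i (rounds n) = n.
Proof.
elim: n => [//|n IH] /=; rewrite count_cat IH count_uniq_mem ?enum_uniq//.
by rewrite mem_enum addn1.
Qed.

Let cell n u := cell_at F u root (rounds n).

Let root_ordered : ordered_cell root.
Proof. exact: ab. Qed.

Definition bisection_point u i : R := infs (fun n => upper (cell n u) i) 0.

Let lower_le_upper m n u i : lower (cell m u) i <= upper (cell n u) i.
Proof.
have := ordered_cell_at F u (rounds (m + n)) root_ordered.
move=> /(_ i); rewrite {1}roundsD addnC roundsD /cell_at !foldl_cat.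
have [+ _] := cell_at_nested F u (rounds n) i
  (ordered_cell_at F u (rounds m) root_ordered).
have [_ +] := cell_at_nested F u (rounds m) i
  (ordered_cell_at F u (rounds n) root_ordered).
by move=> h1 h2 h3; exact: le_trans h2 (le_trans h3 h1).
Qed.

Let has_lbound_upper u i : has_lbound (range (fun n => upper (cell n u) i)).
Proof. by exists (lower (cell 0 u) i) => _ [n _ <-]; exact: lower_le_upper. Qed.

Lemma measurable_bisection_point i :
  measurable_fun setT (bisection_point ^~ i).
Proof.
apply: measurable_fun_infs => [u _|n]; first exact: has_lbound_upper.
exact: measurable_upper_cell_at.
Qed.

Let bisection_pointE u i :
  bisection_point u i = inf (range (fun n => upper (cell n u) i)).
Proof.
by rewrite /bisection_point /infs /sdrop; congr inf; apply/seteqP;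
  split => _ [n _ <-]; exists n.
Qed.

Let bisection_point_le n u i : bisection_point u i <= upper (cell n u) i.
Proof.
by rewrite bisection_pointE; apply: ge_inf; [exact: has_lbound_upper|exists n].
Qed.

Lemma bisection_point_le_corner u i : bisection_point u i <= b i.
Proof. exact: (bisection_point_le 0). Qed.

Let upper_le_bisection_point n (e : R) u i : (b i - a i) / 2 ^+ n <= e ->
  upper (cell n u) i <= bisection_point u i + e.
Proof.
move=> ne; have hw : upper (cell n u) i - lower (cell n u) i <= e.
  by rewrite cell_at_width count_rounds.
have hl : lower (cell n u) i <= bisection_point u i.
  rewrite bisection_pointE; apply: lb_le_inf.
    by exists (upper (cell 0 u) i), 0%N.
  by move=> _ [m _ <-]; exact: lower_le_upper.
by rewrite -lerBlDr (le_trans _ hl)// lerBlDr addrC -lerBlDr.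
Qed.

Let small_cells (e : R) : 0 < e ->
  exists n, forall i, (b i - a i) / 2 ^+ n <= e.
Proof.
move=> e0; pose W := \sum_i (b i - a i).
have ba i : 0 <= b i - a i by rewrite subr_ge0.
have W0 : 0 <= W / e by rewrite divr_ge0 ?sumr_ge0// ltW.
exists (Num.bound (W / e)) => i; rewrite ler_pdivrMr ?exprn_gt0// mulrC.
rewrite -ler_pdivrMr//; apply: (@le_trans _ _ (W / e)).
  by rewrite ler_pM2r ?invr_gt0// /W (bigD1 i)//= lerDl sumr_ge0.
apply: (le_trans (ltW (archi_boundP W0))).
by rewrite -natrX ler_nat ltnW// ltn_expl.
Qed.

Let capped_massE x :
  increment finset.setT F (fun i => Num.min (a i) (x i))
    (fun i => Num.min (b i) (x i)) = F x.
Proof.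
rewrite [RHS]F_cap (_ : (fun i => Num.min (x i) (b i)) =
  fun i => Num.min (b i) (x i)); last by apply/funext => i; rewrite minC.
rewrite /increment (bigD1 finset.set0) ?finset.sub0set//= big1.
  rewrite cards0 expr0 mul1r addr0; congr F; apply/funext => i.
  by rewrite /replace finset.inE.
move=> S /andP[_ /finset.set0Pn[i iS]]; rewrite (@F_vanish _ i) ?mulr0//.
by rewrite /replace iS ge_min lexx.
Qed.

Let massE : increment finset.setT F a b = F b.
Proof.
rewrite -(capped_massE b); congr (increment _ F _ _); apply/funext => i.
  by rewrite min_l.
by rewrite minxx.
Qed.

Let event x : set R :=
  [set u | 0 <= u < F b /\ forall i, bisection_point u i <= x i].

Let measurable_event x : measurable (event x).
Proof.
rewrite (_ : event x = `[0, F b[%classic `&`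
    [set u | forall i, bisection_point u i <= x i]); last first.
  by apply/seteqP; split => u /=; rewrite in_itv.
apply: measurableI; first exact: measurable_itv.
apply: measurable_forall_ord => i.
apply: measurable_fun_ler; last exact: measurable_cst.
exact: measurable_bisection_point.
Qed.

Let slots_sub n x : slots F root (rounds n) x `<=` event x.
Proof.
move=> u [+ H]; rewrite /offset/lower/upper/= add0r massE => ub; split => // i.
exact: le_trans (bisection_point_le n u i) (H i).
Qed.

Let sub_slots n x (e : R) : (forall i, (b i - a i) / 2 ^+ n <= e) ->
  event x `<=` slots F root (rounds n) (fun i => x i + e).
Proof.
move=> ne u [ub H]; split; first by rewrite /offset/lower/upper/= add0r massE.
move=> i; apply: le_trans (upper_le_bisection_point u (ne i)) _.
by rewrite lerD2r.
Qed.

Let event_ge x (e : R) : 0 < e ->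
  ((F x)%:E <= leb (event (fun i => x i + e)%R))%E.
Proof.
move=> /small_cells[n ne].
apply: (@le_trans _ _ (leb (slots F root (rounds n) (fun i => x i + e)%R))).
  rewrite -capped_massE; apply: lebesgue_slots_ge => // i.
  by rewrite count_rounds.
by rewrite le_measure ?inE//; [exact: measurable_slots|exact: measurable_event].
Qed.

Let event_le x (e : R) : 0 < e ->
  (leb (event x) <= (F (fun i => x i + e)%R)%:E)%E.
Proof.
move=> /small_cells[n ne].
apply: (@le_trans _ _ (leb (slots F root (rounds n) (fun i => x i + e)%R))).
  rewrite le_measure ?inE//; [exact: measurable_event|exact: measurable_slots|].
  exact: sub_slots.
by rewrite -capped_massE; exact: lebesgue_slots_le.
Qed.

(** The bisection point lies within one mesh size below the upper corners of its
    cells, so the event below [x] is squeezed between two counts of slots.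
    Right-continuity of [F] closes the upper bound; the lower bound, known for
    [x + e], is transferred to [x] by continuity from above. *)
Lemma lebesgue_bisection_point x :
  (forall e, 0 < e -> exists2 h : R, 0 < h & F (fun i => x i + h) < F x + e) ->
  leb [set u | 0 <= u < F b /\ forall i, bisection_point u i <= x i] = (F x)%:E.
Proof.
move=> rc; apply/le_anti/andP; split.
  apply/lee_addgt0Pr => e e0; have [h h0 Fh] := rc _ e0.
  by apply: (le_trans (event_le x h0)); rewrite -EFinD lee_fin ltW.
have xE : event x = \bigcap_k event (fun i => x i + k.+1%:R^-1).
  apply/seteqP; split => [u [ub H] k _|u H].
    by split => // i; rewrite (le_trans (H i))// lerDl.
  have [ub _] := H 0%N Logic.I; split => // i; apply/ler_addgt0Pr => e e0.
  have [_ /(_ i)] := H (Num.bound e^-1) Logic.I.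
  move=> /le_trans; apply; rewrite lerD2l invf_ple ?posrE//.
  apply: ltW (lt_le_trans (archi_boundP _) _); first by rewrite invr_ge0 ltW.
  by rewrite ler_nat.
have nE : nonincreasing_seq (fun k => event (fun i => x i + k.+1%:R^-1)).
  move=> m n mn; apply/subsetPset => u [ub H]; split => // i.
  by rewrite (le_trans (H i))// lerD2l lef_pV2 ?posrE// ler_nat.
rewrite -/(event x) xE; set E := fun k : nat => event _ in nE *.
have cE : leb \o E @ \oo --> leb (\bigcap_k E k).
  apply: nonincreasing_cvg_mu => //.
  - apply: (@le_lt_trans _ _ (leb `[0, F b[%classic)).
      rewrite le_measure ?inE//; first exact: measurable_event.
      by move=> u [] /=; rewrite in_itv.
    by rewrite lebesgue_measure_itv/=; case: ifP => _; rewrite ltry.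
  - by move=> k; exact: measurable_event.
  - by apply: bigcapT_measurable => k; exact: measurable_event.
rewrite -(cvg_lim _ cE)//; apply: lime_ge.
  by apply/cvg_ex; eexists; exact: cE.
by apply: nearW => k; exact: event_ge.
Qed.

End bisection_limit.

(** * Measures with a density *)

Section integral_mrestr.
Context d (T : measurableType d) (R : realType).
Variables (mu : {measure set T -> \bar R}) (S : set T) (mS : measurable S).

Lemma ge0_integral_mrestr (D : set T) (g : T -> \bar R) :
  measurable D -> measurable_fun D g -> (forall x, D x -> 0 <= g x)%E ->
  (\int[mrestr mu mS]_(x in D) g x = \int[mu]_(x in D `&` S) g x)%E.
Proof.
move=> mD mg g0.
have mDS : measurable (D `\` S) by exact: measurableD.
rewrite -{1}(setUIDK D S) ge0_integral_setU//=; last 4 first.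
- exact: measurableI.
- by rewrite setUIDK.
- by move=> x [[Dx _]|[Dx _]]; exact: g0.
- by apply/disj_set2P; rewrite -subset0 => x [[_ Sx] [_]].
rewrite [X in (_ + X)%E](_ : _ = 0%E) ?adde0; last first.
  rewrite (eq_measure_integral mzero); first by rewrite integral_measure_zero.
  move=> A mA AS; rewrite /= /mrestr (_ : A `&` S = set0) ?measure0//.
  by rewrite -subset0 => x [/AS[_ nSx]].
apply: eq_measure_integral => A mA ADS; rewrite /= /mrestr setIidl//.
by move=> x /ADS[].
Qed.

End integral_mrestr.

Section density.
Context d (T : measurableType d) (R : realType).
Variables (mu : {sigma_finite_measure set T -> \bar R}) (h : T -> R).
Hypotheses (mh : measurable_fun setT h) (h0 : forall x, 0 <= h x).

Local Notation leb := (@lebesgue_measure R).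
Local Notation undergraph :=
  [set p : T * measurableTypeR R | 0 <= (p.2 : R) < h p.1].

Let measurable_undergraph : measurable undergraph.
Proof.
rewrite (_ : undergraph = [set p | (0 <= p.2 :> R) && (p.2 < h p.1)])//.
rewrite -[X in measurable X]setTI -[X in _ `&` X]preimage_true.
have m2 : measurable_fun setT
  (fun p : T * measurableTypeR R => (p.2 : R)) by exact: measurable_snd.
apply: (measurable_and _ _ measurableT) => //.
  by apply: measurable_fun_ler => //; exact: measurable_cst.
apply: measurable_fun_ltr => //; exact: measurableT_comp.
Qed.

(** The measure is the first marginal of the product of [mu] with Lebesgue measure
    restricted to the region under the graph of [h], which makes the change of
    variables an instance of Tonelli's theorem. *)
Lemma exists_density : exists nu : {measure set T -> \bar R},
  forall (D : set T) (g : T -> \bar R), measurable D -> measurable_fun D g ->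
  (forall x, 0 <= g x)%E ->
  (\int[nu]_(x in D) g x = \int[mu]_(x in D) (g x * (h x)%:E))%E.
Proof.
have mf : measurable_fun setT (@fst T (measurableTypeR R)).
  exact: measurable_fst.
have m_fst (D : set T) : measurable D ->
    measurable (@fst T (measurableTypeR R) @^-1` D).
  by move=> mD; rewrite -[X in measurable X]setTI; exact: mf.
pose m : {measure set (T * measurableTypeR R)%type -> \bar R} := (mu \x leb)%E.
pose nu := measure_function_pushforward__canonical__measure_function_Measure
  (mrestr m measurable_undergraph) mf.
exists nu => D g mD mg g0.
have mE : measurable (fst @^-1` D `&` undergraph).
  by apply: measurableI => //; exact: m_fst.
have mgD : measurable_fun setT (g \_ D) by apply/(measurable_restrictT _ mD).
have gD0 x : (0 <= (g \_ D) x)%E by rewrite patchE; case: ifP.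
rewrite (ge0_integral_pushforward mf)//=.
rewrite ge0_integral_mrestr//=; last 2 first.
- exact: m_fst.
- apply: (measurable_comp mD) => //; first by move=> _ [p Dp <-].
  by apply: measurable_funTS; exact: measurable_fst.
rewrite integral_mkcond [RHS]integral_mkcond.
pose G (p : T * measurableTypeR R) :=
  ((g \_ D) p.1 * (\1_undergraph p)%:E)%E.
have mG : measurable_fun setT G.
  apply: emeasurable_funM; first exact: measurableT_comp.
  by apply/measurable_EFinP; exact: measurable_indic.
rewrite (_ : _ \_ _ = G); last first.
  apply/funext => -[x t]; rewrite /G !patchE in_setI indicE/=.
  have -> : ((x, t) \in @fst T (measurableTypeR R) @^-1` D) = (x \in D).
    by apply/idP/idP; rewrite !inE.
  by do 2 case: (_ \in _); rewrite ?mule1 ?mule0 ?mul0e.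
have G0 p : (0 <= G p)%E by rewrite /G mule_ge0// lee_fin.
rewrite (fubini_tonelli1 (m1 := mu) G mG G0).
apply: eq_integral => x _; rewrite /fubini_F/G/=.
have E t : \1_undergraph (x, t) = \1_`[0%R, h x[%classic t :> R.
  rewrite !indicE.
  suff -> : ((x, t) \in undergraph) = (t \in `[0%R, h x[%classic) by [].
  by apply/idP/idP; rewrite !inE/= ?in_itv.
under eq_integral do rewrite E.
rewrite ge0_integralZl//=; last first.
  by apply/measurable_EFinP; exact: measurable_indic.
rewrite !patchE; case: ifPn => xD; last by rewrite mul0e.
congr (_ * _)%E.
have -> : (\int[leb]_t (\1_(`[0%R, h x[%classic) t)%:E = leb `[0%R, h x[)%E.
  by rewrite integral_indic// setIT.
rewrite lebesgue_measure_itv/= lte_fin.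
have := h0 x; rewrite le_eqVlt; case: ltgtP => //= [hx _|<-//].
by rewrite oppr0 adde0.
Qed.

End density.

(** * Borel sets of the orthant *)

Section orthant.
Context {R : realType} {d : nat}.
Local Notation orth := (orthant R d).
Implicit Types (x y u v : orth) (w : 'I_d -> R).

Let to_orthant_subproof w i : 0 < (if 0 < w i then w i else 1).
Proof. by case: ifP. Qed.

(** A total inverse of [coord]; nonpositive entries are replaced by the dummy
    value [1]. *)
Definition to_orthant w : orth := mk_orthant (to_orthant_subproof w).

Lemma coord_to_orthant w i : 0 < w i -> coord (to_orthant w) i = w i.
Proof. by move=> w0; rewrite coord_mk w0. Qed.

Lemma coordK : cancel (@coord R d) to_orthant.
Proof. by move=> x; apply: orthantP => i; rewrite coord_to_orthant// coord_gt0. Qed.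

Definition upper_orthant x : set orth := [set v | ole x v].
Definition lower_orthant x : set orth := [set v | ole v x].

Lemma measurable_upper_orthant x : measurable (upper_orthant x).
Proof.
apply: measurable_forall_ord => i.
by apply: measurable_fun_ler; [exact: measurable_cst|exact: measurable_coord].
Qed.

Lemma measurable_lower_orthant x : measurable (lower_orthant x).
Proof.
apply: measurable_forall_ord => i.
by apply: measurable_fun_ler; [exact: measurable_coord|exact: measurable_cst].
Qed.

Lemma coord_bounded v : exists n, forall i, coord v i <= n.+1%:R.
Proof.
exists (Num.bound (\sum_i coord v i)) => i.
apply: (@le_trans _ _ (\sum_i coord v i)).
  by rewrite (bigD1 i)//= lerDl sumr_ge0// => j _; exact/ltW/coord_gt0.
apply: ltW (lt_le_trans (archi_boundP _) _); last by rewrite ler_nat.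
by apply: sumr_ge0 => j _; exact/ltW/coord_gt0.
Qed.

Lemma coord_bounded_away v : exists n, forall i, n.+1%:R^-1 <= coord v i.
Proof.
have [n vn] := coord_bounded (to_orthant (fun i => (coord v i)^-1)).
exists n => i; have := vn i.
by rewrite coord_to_orthant ?invr_gt0 ?coord_gt0// invf_ple ?posrE// coord_gt0.
Qed.

Lemma measurable_sub_sigma (G : set (set orth)) :
  (forall i, measurable_fun setT
     ((@coord R d)^~ i : g_sigma_algebraType G -> R)) ->
  (@measurable _ orth) `<=` <<s G >>.
Proof.
move=> mG A [B mB <-].
have : measurable_fun setT
    (@orthant_val R d : g_sigma_algebraType G -> d.-tuple (measurableTypeR R)).
  by apply/measurable_fun_tnthP => i; exact: mG.
by move=> /(_ measurableT B mB).
Qed.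

(** For [0 < r] the half-space [v i >= r] is the countable union of the upper
    orthants with corner [r] in direction [i] and [1 / (n + 1)] in the others. *)
Lemma measurable_sub_upper_orthants :
  (@measurable _ orth) `<=` <<s range upper_orthant >>.
Proof.
apply: measurable_sub_sigma => i.
apply: (measurability _ (RGenCInfty.measurableE R)) => _ [_ [r ->] <-].
rewrite setTI; have [r0|r0] := leP r 0.
  rewrite (_ : _ @^-1` _ = setT)//; apply/seteqP; split => // v _.
  by rewrite /= in_itv/= andbT (le_trans r0)// ltW// coord_gt0.
pose z n := to_orthant (fun j => if j == i then r else n.+1%:R^-1).
have zE n j : coord (z n) j = if j == i then r else n.+1%:R^-1.
  by rewrite coord_to_orthant//; case: ifP.
rewrite (_ : _ @^-1` _ = \bigcup_n upper_orthant (z n)).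
  apply: bigcupT_measurable => n; apply: sub_sigma_algebra.
  by exists (z n).
apply/seteqP; split => [v|v [n _ /(_ i)]].
  rewrite /= in_itv/= andbT => rv; have [n vn] := coord_bounded_away v.
  by exists n => // j; rewrite zE; case: eqP => [->|].
by rewrite zE eqxx /= in_itv/= andbT.
Qed.

(** For [0 < r] the half-space [v i <= r] is the countable union of the lower
    orthants with corner [r] in direction [i] and [n + 1] in the others. *)
Lemma measurable_sub_lower_orthants :
  (@measurable _ orth) `<=` <<s range lower_orthant >>.
Proof.
apply: measurable_sub_sigma => i.
apply: (measurability _ (RGenOInfty.measurableE R)) => _ [_ [r ->] <-].
rewrite setTI -setCitvl -preimage_setC; apply: measurableC.
have [r0|r0] := leP r 0.
  rewrite (_ : _ @^-1` _ = set0)// -subset0 => v.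
  by rewrite /= in_itv/= => /(lt_le_trans (coord_gt0 v i)); rewrite ltNge r0.
pose z n := to_orthant (fun j => if j == i then r else n.+1%:R).
have zE n j : coord (z n) j = if j == i then r else n.+1%:R.
  by rewrite coord_to_orthant//; case: ifP.
rewrite (_ : _ @^-1` _ = \bigcup_n lower_orthant (z n)).
  apply: bigcupT_measurable => n; apply: sub_sigma_algebra.
  by exists (z n).
apply/seteqP; split => [v|v [n _ /(_ i)]].
  rewrite /= in_itv/= => rv; have [n vn] := coord_bounded v.
  by exists n => // j; rewrite zE; case: eqP => [->|].
by rewrite zE eqxx /= in_itv.
Qed.

Let invn_orthant n := to_orthant (fun=> n.+1%:R^-1).
Let natn_orthant n := to_orthant (fun=> n.+1%:R).

Lemma upper_orthant_cover : \bigcup_n upper_orthant (invn_orthant n) = setT.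
Proof.
apply/seteqP; split => // v _; have [n vn] := coord_bounded_away v.
by exists n => // i; rewrite coord_to_orthant ?invr_gt0.
Qed.

Lemma lower_orthant_cover : \bigcup_n lower_orthant (natn_orthant n) = setT.
Proof.
apply/seteqP; split => // v _; have [n vn] := coord_bounded v.
by exists n => // i; rewrite coord_to_orthant.
Qed.

Lemma upper_orthantI x y : upper_orthant x `&` upper_orthant y =
  upper_orthant (to_orthant (fun i => Num.max (coord x i) (coord y i))).
Proof.
have E i : coord (to_orthant (fun i => Num.max (coord x i) (coord y i))) i =
    Num.max (coord x i) (coord y i).
  by rewrite coord_to_orthant// lt_max coord_gt0.
apply/seteqP; split => [v [vx vy] i|v H].
  by rewrite E ge_max vx vy.
by split => i; have := H i; rewrite E ge_max => /andP[].
Qed.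

Lemma lower_orthantI x y : lower_orthant x `&` lower_orthant y =
  lower_orthant (to_orthant (fun i => Num.min (coord x i) (coord y i))).
Proof.
have E i : coord (to_orthant (fun i => Num.min (coord x i) (coord y i))) i =
    Num.min (coord x i) (coord y i).
  by rewrite coord_to_orthant// lt_min !coord_gt0.
apply/seteqP; split => [v [vx vy] i|v H].
  by rewrite E le_min vx vy.
by split => i; have := H i; rewrite E le_min => /andP[].
Qed.

Lemma measure_eq_upper_orthants (m1 m2 : {measure set orth -> \bar R}) :
  (forall x, m1 (upper_orthant x) = m2 (upper_orthant x)) ->
  (forall x, (m1 (upper_orthant x) < +oo)%E) ->
  forall A, measurable A -> m1 A = m2 A.
Proof.
move=> m12 fin A /measurable_sub_upper_orthants mA.
apply: (g_sigma_algebra_measure_unique (range upper_orthant) _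
  (fun n => upper_orthant (invn_orthant n))) => //.
- by move=> _ [x _ <-]; exact: measurable_upper_orthant.
- exact: upper_orthant_cover.
- by move=> _ _ [x _ <-] [y _ <-]; rewrite upper_orthantI; eexists.
- by move=> _ [x _ <-].
Qed.

Lemma measure_eq_lower_orthants (m1 m2 : {measure set orth -> \bar R}) :
  (forall x, m1 (lower_orthant x) = m2 (lower_orthant x)) ->
  (forall x, (m1 (lower_orthant x) < +oo)%E) ->
  forall A, measurable A -> m1 A = m2 A.
Proof.
move=> m12 fin A /measurable_sub_lower_orthants mA.
apply: (g_sigma_algebra_measure_unique (range lower_orthant) _
  (fun n => lower_orthant (natn_orthant n))) => //.
- by move=> _ [x _ <-]; exact: measurable_lower_orthant.
- exact: lower_orthant_cover.
- by move=> _ _ [x _ <-] [y _ <-]; rewrite lower_orthantI; eexists.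
- by move=> _ [x _ <-].
Qed.

Lemma sigma_finite_upper_orthants (m : {measure set orth -> \bar R}) :
  (forall x, (m (upper_orthant x) < +oo)%E) -> sigma_finite setT m.
Proof.
move=> fin; exists (fun n => upper_orthant (invn_orthant n)).
  by rewrite upper_orthant_cover.
by move=> n; split; [exact: measurable_upper_orthant|exact: fin].
Qed.

Lemma vol_gt0 v : 0 < vol v.
Proof. by apply: prodr_gt0 => i _; exact: coord_gt0. Qed.

Lemma measurable_vol : measurable_fun setT (@vol R d).
Proof. by apply: measurable_prod => i _; exact: measurable_coord. Qed.

(** The flag [b] tells whether the upper faces of the box are left out. *)
Lemma lebesgue_orthant_below v (b : bool) :
  lebesgue_orthant [set u : orth |
    forall i, [set` Interval -oo%O (BSide b (coord v i))] (coord u i)] =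
  (vol v)%:E.
Proof.
rewrite /lebesgue_orthant.
pose a i : set (measurableTypeR R) :=
  [set` Interval (BRight 0) (BSide b (coord v i))].
rewrite (_ : _ @` _ = [set t | forall i, a i (tnth t i)]); last first.
  apply/seteqP; split => [_ [z zv <-] i|t ta].
    have := zv i; rewrite /a/= !itv_boundlr/= => ->; rewrite andbT.
    exact: (coord_gt0 z i).
  have t0 : [forall i, 0 < (tnth t i : R)].
    by apply/forallP => i; have := ta i; rewrite /a/= itv_boundlr => /andP[].
  exists (Orthant t0) => //= i; have := ta i.
  by rewrite /a/= !itv_boundlr => /andP[].
rewrite lebesgue_tuple_box => [|i]; last exact: measurable_itv.
rewrite /vol -prodEFin; apply: eq_bigr => i _.
by rewrite /a lebesgue_measure_itv/= lte_fin coord_gt0 sube0.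
Qed.

Lemma lebesgue_lower_orthant v : lebesgue_orthant (lower_orthant v) = (vol v)%:E.
Proof. exact: (lebesgue_orthant_below v false). Qed.

Lemma lebesgue_strict_lower_orthant v :
  lebesgue_orthant [set u : orth | forall i, coord u i < coord v i] =
  (vol v)%:E.
Proof. exact: (lebesgue_orthant_below v true). Qed.

End orthant.

(** * From mixing laws to survival functions *)

Section volume_increment.
Context {R : realType} {d : nat}.
Local Notation orth := (orthant R d).

Lemma volumeE (f : orth -> R) x y :
  volume f x y = increment finset.setT (f \o to_orthant) (coord x) (coord y).
Proof.
rewrite /volume /increment; apply: eq_big => S; first by rewrite finset.subsetT.
move=> _; congr (_ * f _); apply: orthantP => i.
rewrite coord_mk coord_to_orthant// /replace.
by case: ifP => _; exact: coord_gt0.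
Qed.

Lemma increment_swap (F : ('I_d -> R) -> R) p q :
  increment finset.setT F q p = (-1) ^+ d * increment finset.setT F p q.
Proof.
rewrite /increment mulr_sumr.
rewrite (reindex_inj (@finset.setC_inj _)); apply: eq_big => S.
  by rewrite !finset.subsetT.
move=> _; rewrite mulrA; congr (_ * F _); last first.
  by apply/funext => i; rewrite /replace finset.inE; case: (i \in S).
have -> : (-1) ^+ d = (-1) ^+ (#|S| + #|~: S|%SET) :> R.
  by rewrite cardsC card_ord.
by rewrite exprD mulrAC -exprD addnn -mul2n exprM sqrrN !expr1n mul1r.
Qed.

Definition survival_of (m : set orth -> \bar R) (f : orth -> R) :=
  forall x, m (upper_orthant x) = (f x)%:E.

(** Inclusion-exclusion, one direction at a time: the slab [v i < y i] is the
    difference of the upper orthants at [x] and at [x] with [x i] moved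
    to [y i]. *)
Lemma survival_box (m : {measure set orth -> \bar R}) (f : orth -> R)
    (A : {set 'I_d}) x y : survival_of m f -> ole x y ->
  m [set v | forall i, (coord x i <= coord v i) &&
                       ((i \in A) ==> (coord v i < coord y i))] =
  (increment A (f \o to_orthant) (coord y) (coord x))%:E.
Proof.
move=> mf; have [n An] := ubnP #|A|; elim: n => // n IH in A An x * => xy.
have [->|/finset.set0Pn[i iA]] := eqVneq A finset.set0.
  rewrite increment0 /= coordK -mf; congr (m _); apply/seteqP.
  by split => v H i; have := H i; rewrite finset.in_set0 implyFb andbT.
have cA : (#|A :\ i|%SET < n)%N.
  by rewrite -ltnS (leq_trans _ An)// ltnS [leqRHS](cardsD1 i) iA.
rewrite (incrementD1 _ _ _ iA) EFinB -IH//.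
pose x' := to_orthant (set_coord (coord x) i (coord y i)).
have x'E : coord x' = set_coord (coord x) i (coord y i).
  apply/funext => j; rewrite coord_to_orthant// /set_coord.
  by case: ifP => _; exact: coord_gt0.
have x'y : ole x' y by move=> j; rewrite x'E /set_coord; case: eqP => [->|].
rewrite -x'E -IH//.
have mE (z : orth) (B : {set 'I_d}) : measurable
  [set v | forall j, (coord z j <= coord v j) &&
                     ((j \in B) ==> (coord v j < coord y j))].
  apply: measurable_forall_ord => j; apply: measurable_and.
    by apply: measurable_fun_ler; [exact: measurable_cst|exact: measurable_coord].
  case: (j \in B) => /=; last exact: measurable_cst.
  by apply: measurable_fun_ltr; [exact: measurable_coord|exact: measurable_cst].
set E := (X in (m X - _)%E); set E' := (X in (_ - m X)%E).
have E'E : E' `<=` E.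
  move=> v H j; have /andP[+ ->] := H j; rewrite x'E andbT; apply: le_trans.
  by rewrite /set_coord; case: eqP => // ->.
rewrite -(setIidr E'E) -measureD//; last 3 first.
- exact: mE.
- exact: mE.
- apply: (@le_lt_trans _ _ (m (upper_orthant x))); last by rewrite mf ltry.
  rewrite le_measure ?inE//; [exact: mE|exact: measurable_upper_orthant|].
  by move=> v H j; have /andP[] := H j.
congr (m _); apply/seteqP; split => [v H|v [H nH] j].
  split => [j|/(_ i)].
    by have := H j; rewrite !finset.inE; case: (j == i) => //= /andP[->].
  have := H i; rewrite iA x'E set_coord_eq /= => /andP[_ vy].
  by rewrite leNgt vy.
have := H j; rewrite !finset.inE; have [->|//] := eqVneq j i.
rewrite /= andbT => -> /=; rewrite iA ltNge; apply/negP => yv.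
apply: nH => k; have := H k; rewrite x'E /set_coord.
by have [->|//] := eqVneq k i; rewrite yv !finset.inE eqxx.
Qed.

Lemma survival_volume (m : {measure set orth -> \bar R}) (f : orth -> R) :
  survival_of m f -> extends_volume f m.
Proof.
move=> mf x y xy; rewrite volumeE -increment_swap -(survival_box _ mf xy).
by congr (m _); apply/seteqP; split => v H i; have := H i; rewrite finset.inE.
Qed.

End volume_increment.

Lemma measurable_box_oc {R : realType} {d : nat} (u x : orthant R d) :
  measurable (box_oc u x).
Proof.
apply: measurable_forall_ord => i; apply: measurable_and.
  by apply: measurable_fun_ltr; [exact: measurable_cst|exact: measurable_coord].
by apply: measurable_fun_ler; [exact: measurable_coord|exact: measurable_cst].
Qed.

Lemma measurable_fun_orthant {R : realType} {d : nat} disp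
    (T : measurableType disp) (h : T -> orthant R d) :
  (forall i, measurable_fun setT (fun t => coord (h t) i)) ->
  measurable_fun setT h.
Proof.
move=> mh _ _ [B mB <-]; rewrite !setTI.
have : measurable_fun setT (@orthant_val R d \o h).
  by apply/measurable_fun_tnthP => i; exact: mh.
by move=> /(_ measurableT B mB); rewrite setTI.
Qed.

Lemma measurable_coord_fst {R : realType} {d : nat} (i : 'I_d) :
  measurable_fun setT (fun p : orthant R d * orthant R d => coord p.1 i).
Proof. exact: (measurableT_comp (measurable_coord i) measurable_fst). Qed.

Lemma measurable_coord_snd {R : realType} {d : nat} (i : 'I_d) :
  measurable_fun setT (fun p : orthant R d * orthant R d => coord p.2 i).
Proof. exact: (measurableT_comp (measurable_coord i) measurable_snd). Qed.

Section mixing_law.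
Context {R : realType} {d : nat}.
Local Notation orth := (orthant R d).
Variable P : probability orth R.

Lemma measurable_inv_vol : measurable_fun setT (fun v : orth => (vol v)^-1).
Proof. exact: (measurableT_comp measurable_invr measurable_vol). Qed.

Lemma le_vol (u v : orth) : ole u v -> vol u <= vol v.
Proof. by move=> uv; apply: ler_prod => i _; rewrite uv ltW// coord_gt0. Qed.

Lemma exists_inverse_volume_measure : exists mu : {measure set orth -> \bar R},
  forall A, measurable A -> mu A = (\int[P]_(v in A) ((vol v)^-1)%:E)%E.
Proof.
have vol0 (v : orth) : 0 <= (vol v)^-1 by rewrite invr_ge0 ltW// vol_gt0.
have [mu muE] := exists_density P measurable_inv_vol vol0.
exists mu => A mA; have := muE A (cst 1%E) mA (measurable_cst _) (fun=> lee01).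
rewrite integral_cst// mul1e => ->.
by apply: eq_integral => v _; rewrite mul1e.
Qed.

Variable mu : {measure set orth -> \bar R}.
Hypothesis muE : forall A, measurable A ->
  mu A = (\int[P]_(v in A) ((vol v)^-1)%:E)%E.

(** The content is finiteness, which allows to pass from extended to real values:
    above [x] the density is at most [1 / vol x]. *)
Lemma inverse_volume_measure_survival :
  survival_of mu (fun x => \int[P]_(v in upper_orthant x) (vol v)^-1).
Proof.
move=> x; rewrite /Rintegral -muE ?fineK//; last exact: measurable_upper_orthant.
rewrite ge0_fin_numE// muE; last exact: measurable_upper_orthant.
apply: (@le_lt_trans _ _ (\int[P]_(v in upper_orthant x) ((vol x)^-1)%:E)%E).
  apply: ge0_le_integral => //.
  - exact: measurable_upper_orthant.
  - by move=> v _; rewrite lee_fin invr_ge0 ltW// vol_gt0.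
  - by apply/measurable_EFinP; apply: measurable_funTS; exact: measurable_inv_vol.
  - by move=> v xv; rewrite lee_fin lef_pV2 ?posrE ?vol_gt0// le_vol.
rewrite integral_cst; last exact: measurable_upper_orthant.
rewrite (@le_lt_trans _ _ ((vol x)^-1)%:E) ?ltry//.
rewrite -[leRHS]mule1 lee_wpmul2l ?probability_le1//.
  by rewrite lee_fin invr_ge0 ltW// vol_gt0.
exact: measurable_upper_orthant.
Qed.

Let box x (p : orth * orth) : bool :=
  [forall i, coord p.1 i < coord p.2 i <= coord x i].

Let measurable_box x : measurable [set p | box x p].
Proof.
rewrite (_ : [set p | _] =
  [set p | forall i, coord p.1 i < coord p.2 i <= coord x i]); last first.
  by apply/seteqP; split => p /= /forallP.
apply: measurable_forall_ord => i; apply: measurable_and.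
  by apply: measurable_fun_ltr;
    [exact: measurable_coord_fst|exact: measurable_coord_snd].
by apply: measurable_fun_ler;
  [exact: measurable_coord_snd|exact: measurable_cst].
Qed.

(** After exchanging the integrals, the inner one is the Lebesgue measure of
    the points [u < v], which cancels the density [1 / vol v]. *)
Lemma integral_inverse_volume_measure x :
  (\int[@lebesgue_orthant R d]_u
     (mu (box_oc u x) * (\1_[set w : orth | ole w x] u)%:E) =
   P (lower_orthant x))%E.
Proof.
pose K (p : orth * orth) : \bar R :=
  ((vol p.2)^-1%:E * (\1_[set p | box x p] p)%:E)%E.
have mK : measurable_fun setT K.
  apply: emeasurable_funM; apply/measurable_EFinP.
    exact: (measurableT_comp measurable_inv_vol measurable_snd).
  by apply: measurable_indic; exact: measurable_box.
have K0 p : (0 <= K p)%E.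
  by rewrite /K mule_ge0// lee_fin// invr_ge0 ltW// vol_gt0.
transitivity (\int[@lebesgue_orthant R d]_u \int[P]_v K (u, v))%E.
  apply: eq_integral => u _.
  have mbox := measurable_box_oc u x.
  transitivity (mu (box_oc u x)).
    rewrite indicE; have [ux|ux] := boolP (u \in _); first by rewrite mule1.
    rewrite mule0 (_ : box_oc u x = set0) ?measure0// -subset0 => v uvx.
    move: ux; rewrite notin_setE /=; apply => i.
    by have /andP[/ltW/le_trans] := uvx i; apply.
  rewrite muE// integral_mkcond; apply: eq_integral => v _.
  rewrite patchE /K indicE/=.
  have -> : ((u, v) \in [set p | box x p]) = (v \in box_oc u x).
    by apply/idP/idP; rewrite !inE/= => /forallP.
  by case: ifP => _; rewrite ?mule1 ?mule0.
rewrite (fubini_tonelli (m1 := @lebesgue_orthant R d) (m2 := P) K mK K0).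
transitivity (\int[P]_v (\1_(lower_orthant x) v)%:E)%E; last first.
  by rewrite integral_indic ?setIT//; exact: measurable_lower_orthant.
apply: eq_integral => v _; rewrite /K/=.
have vol0 : (0 <= ((vol v)^-1)%:E)%E by rewrite lee_fin invr_ge0 ltW// vol_gt0.
have mlt : measurable [set u : orth | forall i, coord u i < coord v i].
  apply: measurable_forall_ord => i.
  by apply: measurable_fun_ltr; [exact: measurable_coord|exact: measurable_cst].
rewrite indicE; have [vx|vx] := boolP (v \in _).
  under eq_integral => u _.
    rewrite (_ : \1_[set p | box x p] (u, v) =
      \1_[set u : orth | forall i, coord u i < coord v i] u); last first.
      rewrite !indicE; suff -> : ((u, v) \in [set p | box x p]) =
          (u \in [set u : orth | forall i, coord u i < coord v i]) by [].
      apply/idP/idP; rewrite !inE/=.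
        by move=> /forallP H i; have /andP[] := H i.
      move: vx; rewrite inE => vx H; apply/forallP => i; rewrite H/=.
      exact: vx.
    over.
  rewrite ge0_integralZl//; last first.
    by apply/measurable_EFinP; exact: measurable_indic.
  rewrite integral_indic// setIT [X in (_ * X)%E]lebesgue_strict_lower_orthant.
  rewrite -EFinM.
  by rewrite mulVf// gt_eqF// vol_gt0.
rewrite integral0_eq// => u _; rewrite indicE memNset ?mule0//= => /forallP H.
by move: vx; rewrite notin_setE; apply => i; have /andP[] := H i.
Qed.

End mixing_law.

Section smu_density_survival.
Context {R : realType} {d : nat}.
Local Notation orth := (orthant R d).

Lemma dist_fun_law (G : orth -> R) :
  distribution_functions G -> dist_fun (law G) = G.
Proof. by move=> [P PG]; rewrite /law; case: xgetP => // /(_ P). Qed.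

Lemma exists_survival_measure (G : orth -> R) : distribution_functions G ->
  exists2 mu : {measure set orth -> \bar R}, survival_of mu (smu_density G) &
  forall x, ((G x)%:E = \int[@lebesgue_orthant R d]_u
    (mu (box_oc u x) * (\1_[set w : orth | ole w x] u)%:E))%E.
Proof.
move=> dG; have [mu muE] := exists_inverse_volume_measure (law G).
exists mu; first exact: inverse_volume_measure_survival.
move=> x; rewrite (integral_inverse_volume_measure muE) -{1}(dist_fun_law dG).
rewrite /dist_fun fineK// ge0_fin_numE//.
apply: le_lt_trans (ltry 1); apply: probability_le1.
exact: measurable_lower_orthant.
Qed.

Lemma smu_density_inj :
  {in @distribution_functions R d &, injective (@smu_density R d)}.
Proof.
move=> G1 G2; rewrite !inE => dG1 dG2 G12.
have [mu1 mu1E G1E] := exists_survival_measure dG1.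
have [mu2 mu2E G2E] := exists_survival_measure dG2.
have mu12 A : measurable A -> mu1 A = mu2 A.
  apply: measure_eq_upper_orthants => x; first by rewrite mu1E mu2E G12.
  by rewrite mu1E ltry.
apply/funext => x; apply: EFin_inj; rewrite G1E G2E.
apply: eq_integral => u _; rewrite mu12//; exact: measurable_box_oc.
Qed.

End smu_density_survival.

(** * From completely monotone densities to survival functions of measures *)

Section positivity.
Context {R : realType} {d : nat}.
Local Notation orth := (orthant R d).
Variable f : orth -> R.
Hypothesis f_usc : upper_semicontinuous f.
Hypothesis f_vanish : vanishes_at_infinity_coordinatewise f.
Hypothesis f_volume : forall x y, ole x y -> 0 <= (-1) ^+ d * volume f x y.
Implicit Types (x y : orth) (p q w : 'I_d -> R) (A : {set 'I_d}).

Local Notation g := (f \o to_orthant).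

Let vanish_near x i (e : R) : 0 < e ->
  \forall N \near +oo, `|g (set_coord (coord x) i N)| < e.
Proof.
move=> e0; have [M HM] := f_vanish x i e0.
near=> N; apply: HM.
  move=> j ji; rewrite coord_to_orthant /set_coord ?(negbTE ji)//.
  exact: coord_gt0.
have N0 : 0 < N by near: N; apply: nbhs_pinfty_gt; exact: num_real.
rewrite coord_to_orthant set_coord_eq//.
by near: N; apply: nbhs_pinfty_gt; exact: num_real.
Unshelve. all: by end_near. Qed.

Let increment_vanish_near x y i A (e : R) : i \notin A -> 0 < e ->
  \forall N \near +oo,
    `|increment A g (coord y) (set_coord (coord x) i N)| < e.
Proof.
move=> iA e0; pose c : R := #|{set 'I_d}|%:R.
have c0 : 0 < c by rewrite ltr0n; apply/card_gt0P; exists finset.set0.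
(* No vertex uses direction i, so as N varies the vertex of S runs along the line
   through z S in direction i. *)
pose z (S : {set 'I_d}) := to_orthant (replace (S :\ i)%SET (coord y) (coord x)).
have zE S : coord (z S) = replace (S :\ i)%SET (coord y) (coord x).
  apply/funext => j; rewrite coord_to_orthant// /replace.
  by case: ifP => _; exact: coord_gt0.
have : \forall N \near +oo, forall S,
    `|g (set_coord (coord (z S)) i N)| < e / c.
  by apply: filter_forall => S; apply: vanish_near; rewrite divr_gt0.
apply: filterS => N HN; rewrite /increment.
apply: (@le_lt_trans _ _ (\sum_(S : {set 'I_d} | S \subset A)
    `|g (set_coord (coord (z S)) i N)|)).
  apply: (le_trans (ler_norm_sum _ _ _)); apply: ler_sum => S SA.
  rewrite normrM normrX normrN1 expr1n mul1r zE le_eqVlt; apply/orP; left.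
  apply/eqP; congr (`|g _|); apply/funext => j.
  rewrite /replace /set_coord !finset.inE; have [->|//] := eqVneq j i.
  by case: ifP => // iS; move: iA; rewrite (fintype.subsetP SA).
apply: (@lt_le_trans _ _ (\sum_(S : {set 'I_d}) e / c)).
  rewrite [ltRHS](bigID (fun S : {set 'I_d} => S \subset A))/= ltr_wpDr//.
    by apply: sumr_ge0 => S _; rewrite divr_ge0// ltW.
  apply: ltr_sum => [|S _]; last exact: HN.
  apply/hasP; exists finset.set0; first exact: mem_index_enum.
  exact: finset.sub0set.
by rewrite sumr_const -[leLHS]mulr_natr -/c divfK// gt_eqF.
Qed.

(** Downward induction on the set of directions: when the upper corner goes to
    infinity in direction [i], all vertices that use it contribute nothing in the
    limit, and the difference in direction [i] disappears. *)
Lemma survival_increment_ge0 A x y : ole x y ->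
  0 <= increment A g (coord y) (coord x).
Proof.
have [n An] := ubnP #|~: A|%SET; elim: n => // n IH in A An x y *.
move=> xy; have [AT|] := eqVneq (~: A)%SET finset.set0.
  rewrite (_ : A = finset.setT); last first.
    by rewrite -(finset.setCK A) AT finset.setC0.
  by rewrite increment_swap -volumeE f_volume.
move=> /finset.set0Pn[i]; rewrite finset.inE => iA.
have cA : (#|~: (i |: A)|%SET < n)%N.
  rewrite -ltnS (leq_trans _ An)// ltnS.
  apply: proper_card; apply/properP; split.
    by rewrite finset.setCS finset.subsetU1.
  by exists i; rewrite !finset.inE ?eqxx.
rewrite leNgt; apply/negP => a0.
have Na : 0 < - increment A g (coord y) (coord x) by rewrite oppr_gt0.
near (@pinfty_nbhs R) => N.
have yN : coord y i <= N by near: N; apply: nbhs_pinfty_ge; exact: num_real.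
have N0 : 0 < N by apply: lt_le_trans yN; exact: coord_gt0.
pose y' := to_orthant (set_coord (coord y) i N).
have y'E : coord y' = set_coord (coord y) i N.
  apply/funext => j; rewrite coord_to_orthant// /set_coord.
  by case: ifP => // _; exact: coord_gt0.
have xy' : ole x y'.
  move=> j; rewrite y'E /set_coord; case: eqP => [->|_]; last exact: xy.
  exact: le_trans (xy i) yN.
have := IH _ cA _ _ xy'; rewrite incrementU1// y'E set_coord_eq.
have E : {in A, set_coord (coord y) i N =1 coord y}.
  move=> j jA; rewrite /set_coord; case: eqP => // ji.
  by move: (iA); rewrite -ji jA.
rewrite !(eq_increment_lower _ _ E).
have : `|increment A g (coord y) (set_coord (coord x) i N)| <
    - increment A g (coord y) (coord x).
  by near: N; exact: increment_vanish_near.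
rewrite ltr_norml opprK => /andP[h _]; apply/negP; rewrite -ltNge subr_lt0.
exact: h.
Unshelve. all: by end_near. Qed.

(** In the coordinates [1 / x] the survival function becomes a distribution
    function, and the behaviour of [f] at infinity becomes its vanishing on the
    coordinate hyperplanes. *)
Definition inverted_survival w : R :=
  if [forall i, 0 < w i] then g (fun i => (w i)^-1) else 0.

Local Notation F := inverted_survival.

Lemma inverted_survival_vanish w i : w i <= 0 -> F w = 0.
Proof.
move=> wi; rewrite /F; case: ifP => // /forallP/(_ i).
by rewrite ltNge wi.
Qed.

Lemma inverted_survivalE x : F (fun i => (coord x i)^-1) = f x.
Proof.
rewrite /F ifT; last by apply/forallP => i; rewrite invr_gt0 coord_gt0.
by rewrite /=; under [X in to_orthant X]funext do rewrite invrK; rewrite coordK.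
Qed.

(** Vertices outside the open orthant contribute nothing, so directions in which
    the lower corner is nonpositive can be dropped. *)
Lemma inverted_survival_increments : nonneg_increments F.
Proof.
move=> A p q pq; have [|/forallPn[i]] := boolP [forall i, 0 < q i]; last first.
  rewrite -leNgt => qi; rewrite /increment big1// => S _.
  rewrite (@inverted_survival_vanish _ i) ?mulr0// /replace.
  by case: ifP => // _; exact: le_trans (pq i) qi.
move=> /forallP q0; have [n An] := ubnP #|A|; elim: n => // n IH in A An *.
have [/'exists_andP[i [iA pi]]|] := boolP [exists i, (i \in A) && (p i <= 0)].
  rewrite (incrementD1 _ _ _ iA) [X in _ - X](_ : _ = 0) ?subr0.
    by apply: IH; rewrite -ltnS (leq_trans _ An)// ltnS [leqRHS](cardsD1 i) iA.
  rewrite /increment big1// => S SA.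
  rewrite (@inverted_survival_vanish _ i) ?mulr0// /replace set_coord_eq.
  by case: ifP.
rewrite negb_exists => /forallP pA.
have p0 i : i \in A -> 0 < p i.
  by move=> iA; have := pA i; rewrite iA/= -ltNge.
pose x := to_orthant (fun i => (q i)^-1).
pose y := to_orthant (fun i => if i \in A then (p i)^-1 else (q i)^-1).
have xE i : coord x i = (q i)^-1 by rewrite coord_to_orthant// invr_gt0.
have yE i : coord y i = if i \in A then (p i)^-1 else (q i)^-1.
  by rewrite coord_to_orthant//; case: ifPn => iA; rewrite invr_gt0 ?p0.
have xy : ole x y.
  by move=> i; rewrite xE yE; case: ifP => // /p0 pi; rewrite lef_pV2 ?posrE.
have := survival_increment_ge0 A xy.
rewrite (@eq_increment _ _ A g F _ p _ q)// => S SA.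
rewrite /F ifT.
  congr g; apply/funext => i; rewrite /replace yE xE.
  by case: ifP => // /(fintype.subsetP SA) ->.
apply/forallP => i; rewrite /replace.
by case: ifP => // /(fintype.subsetP SA)/p0.
Qed.

(** Inside the open orthant this is upper semi-continuity of [f]; elsewhere it is
    the decay of [f] along one coordinate, carried to the other coordinates by
    monotonicity. *)
Lemma inverted_survival_right_continuous w (e : R) : 0 < e ->
  exists2 h : R, 0 < h & F (fun i => w i + h) < F w + e.
Proof.
move=> e0; have [/forallP w0|/forallPn[i]] := boolP [forall i, 0 < w i].
  pose z := to_orthant (fun i => (w i)^-1).
  have zE i : coord z i = (w i)^-1 by rewrite coord_to_orthant// invr_gt0.
  have [|r r0 zr] := f_usc (x := z) (a := f z + e); first by rewrite ltrDl.
  have [n wn] := coord_bounded_away (to_orthant w).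
  have wn' i : n.+1%:R^-1 <= w i by have := wn i; rewrite coord_to_orthant.
  pose m : R := n.+1%:R^-1; have m0 : 0 < m by rewrite invr_gt0.
  (* Moving w by h moves 1 / w by at most h / m ^ 2. *)
  pose h := r * m ^+ 2 / 2; have h0 : 0 < h by rewrite !mulr_gt0 ?exprn_gt0.
  exists h => //.
  have wh i : 0 < w i + h by rewrite addr_gt0.
  have whE : F (fun i => w i + h) = f (to_orthant (fun i => (w i + h)^-1)).
    by rewrite /F ifT//; apply/forallP.
  have -> : F w = f z by rewrite /F ifT//; apply/forallP.
  rewrite whE; apply: zr => i; rewrite zE coord_to_orthant ?invr_gt0//.
  have -> : (w i + h)^-1 - (w i)^-1 = - (h / ((w i + h) * w i)).
    by field; rewrite !gt_eqF.
  rewrite normrN ger0_norm ?divr_ge0 ?mulr_ge0 ?ltW//.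
  rewrite ltr_pdivrMr ?mulr_gt0//.
  apply: (@lt_le_trans _ _ (r * m ^+ 2)).
    by rewrite /h ltr_pdivrMr// ltr_pMr ?mulr_gt0 ?exprn_gt0// ltr1n.
  rewrite ler_pM2l// expr2 ler_pM ?(ltW m0)//.
  by rewrite (le_trans (wn' i))// lerDl ltW.
rewrite -leNgt => wi.
pose v := fun j => Num.max (w j) 0 + 1.
have v0 j : 0 < v j.
  by rewrite /v (@lt_le_trans _ _ 1)// lerDr le_max lexx orbT.
pose z := to_orthant (fun j => (v j)^-1).
have zE j : coord z j = (v j)^-1 by rewrite coord_to_orthant// invr_gt0.
have [M HM] := f_vanish z i e0.
(* In direction i the inverted point has coordinate k, beyond M; the bound 1 <= k
   keeps the increment 1 / k below the margin 1 left in v. *)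
pose k := `|M| + 1; have k1 : 1 <= k by rewrite lerDr.
have k0 : 0 < k by exact: lt_le_trans k1.
exists k^-1; first by rewrite invr_gt0.
rewrite (inverted_survival_vanish wi) add0r.
apply: (@le_lt_trans _ _ (F (set_coord v i k^-1))).
  apply: nonneg_increments_mono; first exact: inverted_survival_increments.
  move=> j; rewrite /set_coord; case: eqP => [->|_]; first by rewrite gerDr.
  by rewrite lerD ?invf_le1// le_max lexx.
pose z' := to_orthant (fun j => (set_coord v i k^-1 j)^-1).
have vk j : 0 < set_coord v i k^-1 j.
  by rewrite /set_coord; case: ifP => // _; rewrite invr_gt0.
have -> : F (set_coord v i k^-1) = f z' by rewrite /F ifT//; apply/forallP.
apply: le_lt_trans (ler_norm _) (HM z' _ _).
  move=> j ji; rewrite zE coord_to_orthant ?invr_gt0//.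
  by rewrite /set_coord (negbTE ji).
rewrite coord_to_orthant ?invr_gt0// set_coord_eq invrK /k.
by rewrite (le_lt_trans (ler_norm M))// ltrDl.
Qed.

End positivity.

Section truncated_measure.
Context {R : realType} {d : nat}.
Local Notation orth := (orthant R d).
Local Notation leb := (@lebesgue_measure R).
Variable f : orth -> R.
Hypothesis f_usc : upper_semicontinuous f.
Hypothesis f_vanish : vanishes_at_infinity_coordinatewise f.
Hypothesis f_volume : forall x y, ole x y -> 0 <= (-1) ^+ d * volume f x y.
Implicit Types (x : orth) (w : 'I_d -> R).

Local Notation F := (inverted_survival f).

(** The upper orthant at [truncate n x] is the part of the upper orthant at [x]
    that keeps the distance [1 / (n + 1)] from the coordinate hyperplanes. *)
Definition truncate (n : nat) x : orth :=
  to_orthant (fun i => Num.max (coord x i) n.+1%:R^-1).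

Lemma coord_truncate n x i :
  coord (truncate n x) i = Num.max (coord x i) n.+1%:R^-1.
Proof. by rewrite coord_to_orthant// lt_max coord_gt0. Qed.

Variable n : nat.
Let c : R := n.+1%:R.
Let c0 : 0 < c. Proof. by rewrite ltr0n. Qed.
Let Fn w := F (fun i => Num.min (w i) c).
Let origin : 'I_d -> R := fun=> 0.
Let corner : 'I_d -> R := fun=> c.
Let T := bisection_point Fn origin corner.

Let Fn_increments : nonneg_increments Fn.
Proof.
move=> A p q pq; rewrite (increment_comp A F (fun _ r => Num.min r c)).
apply: inverted_survival_increments => // i.
by rewrite le_min2.
Qed.

Let Fn_vanish w i : w i <= origin i -> Fn w = 0.
Proof.
by move=> wi; apply: (@inverted_survival_vanish _ _ _ _ i); rewrite ge_min wi.
Qed.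

Let Fn_cap w : Fn w = Fn (fun i => Num.min (w i) (corner i)).
Proof.
by congr F; apply/funext => i; rewrite /corner -minA minxx.
Qed.

Let lebesgue_T w :
  leb [set u | 0 <= u < Fn corner /\ forall i, T u i <= w i] = (Fn w)%:E.
Proof.
apply: lebesgue_bisection_point => // e e0.
have [h h0 Fh] := inverted_survival_right_continuous f_usc f_vanish f_volume
  (fun i => Num.min (w i) c) e0.
exists h => //; apply: le_lt_trans Fh; apply: (@nonneg_increments_mono _ _ F).
  exact: inverted_survival_increments.
move=> i; case: (leP (w i) c) => wc; first by rewrite ge_min lexx.
by rewrite ge_min [X in _ || X](_ : _ = true) ?orbT// lerDl ltW.
Qed.

Let mT i : measurable_fun setT (T ^~ i).
Proof. exact: measurable_bisection_point. Qed.

Let slot : set R := `[0, Fn corner[%classic.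

(* Inversion of the bisection point makes sense almost everywhere because Fn
   vanishes on the coordinate hyperplanes. *)
Let T_positive_ae :
  leb.-negligible [set u | slot u /\ exists i, T u i <= 0].
Proof.
pose Z i : set R := [set u | 0 <= u < Fn corner /\
  forall j, T u j <= set_coord corner i 0 j].
have mZ i : measurable (Z i).
  rewrite (_ : Z i = slot `&`
      [set u | forall j, T u j <= set_coord corner i 0 j]).
    apply: measurableI; first exact: measurable_itv.
    apply: measurable_forall_ord => j.
    by apply: measurable_fun_ler; [exact: mT|exact: measurable_cst].
  by apply/seteqP; split => u; rewrite /slot/= in_itv.
have Z0 i : leb.-negligible (Z i).
  exists (Z i); split; [exact: mZ| |by []].
  by rewrite [LHS]lebesgue_T (@Fn_vanish _ i)// set_coord_eq.
have : leb.-negligible (\big[setU/set0]_(i < d) Z i).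
  elim/big_ind : _ => //; first exact: negligible_set0.
  by move=> A B; exact: negligibleU.
apply: negligibleS => u [+ [i Ti]].
rewrite (bigD1 i)//= /slot/= in_itv/= => us; left; split => // j.
rewrite /set_coord; case: eqP => [->//|_].
exact: bisection_point_le_corner.
Qed.

Let point u : orth := to_orthant (fun i => (T u i)^-1).

Let measurable_point : measurable_fun setT point.
Proof.
apply: measurable_fun_orthant => i.
rewrite (_ : (fun u => _) = fun u => if 0 < (T u i)^-1 then (T u i)^-1 else 1).
  have mTV : measurable_fun setT (fun u => (T u i)^-1).
    exact: (measurableT_comp measurable_invr (mT i)).
  by apply: measurable_fun_ifT => //; apply: measurable_fun_ltr.
by apply/funext => u; rewrite coord_mk.
Qed.

(** The image of Lebesgue measure under the bisection point followed by inversion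
    of the coordinates. *)
Lemma exists_truncated_measure : exists m : {measure set orth -> \bar R},
  survival_of m (f \o truncate n).
Proof.
have mslot : measurable slot by exact: measurable_itv.
pose m := measure_function_pushforward__canonical__measure_function_Measure
  (mrestr leb mslot) measurable_point.
exists m => x.
pose w i := (coord x i)^-1.
pose E := [set u | 0 <= u < Fn corner /\ forall i, T u i <= w i].
have mE : measurable E.
  rewrite (_ : E = slot `&` [set u | forall j, T u j <= w j]).
    apply: measurableI; first exact: measurable_itv.
    apply: measurable_forall_ord => j.
    by apply: measurable_fun_ler; [exact: mT|exact: measurable_cst].
  by apply/seteqP; split => u; rewrite /slot/= in_itv.
have -> : (f \o truncate n) x = Fn w.
  rewrite /= -inverted_survivalE /Fn; congr F; apply/funext => i.
  rewrite coord_truncate /w /c; have [cx|cx] := leP (coord x i) n.+1%:R^-1.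
    by rewrite invrK min_r// -[leLHS]invrK lef_pV2 ?posrE ?invr_gt0 ?coord_gt0.
  by rewrite min_l// invf_ple ?posrE ?coord_gt0// ltW.
rewrite -lebesgue_T -/E /m/= /pushforward /mrestr.
have mA : measurable (point @^-1` upper_orthant x `&` slot).
  apply: measurableI => //; rewrite -[X in measurable X]setTI.
  by apply: measurable_point => //; exact: measurable_upper_orthant.
have [B [mB B0 NB]] := T_positive_ae.
apply/le_anti/andP; split.
  rewrite le_measure ?inE// => u [xu]; rewrite /slot/= in_itv/= => us.
  split => // i; have [Ti|Ti] := leP (T u i) 0.
    by rewrite (le_trans Ti)// invr_ge0 ltW// coord_gt0.
  have := xu i; rewrite coord_to_orthant ?invr_gt0// => xT.
  by rewrite /w -[leLHS]invrK lef_pV2 ?posrE ?invr_gt0// coord_gt0.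
apply: (@le_trans _ _ (leb ((point @^-1` upper_orthant x `&` slot) `|` B))).
  rewrite le_measure ?inE//; first exact: measurableU.
  move=> u [us Tw]; have us' : slot u by rewrite /slot/= in_itv.
  have [T0|/existsNP[i Ti]] := pselect (forall i, 0 < T u i).
    left; split => // i; rewrite coord_to_orthant ?invr_gt0//.
    have := Tw i; rewrite /w => Tx.
    by rewrite -[leLHS]invrK lef_pV2 ?posrE ?invr_gt0// coord_gt0.
  right; apply: NB; split => //; exists i.
  by rewrite leNgt; apply/negP.
apply: (le_trans (measureU2 leb mA mB)).
by rewrite [X in (_ + X)%E]B0 adde0.
Qed.

End truncated_measure.

Section gluing.
Context {R : realType} {d : nat}.
Local Notation orth := (orthant R d).
Variables (f : orth -> R) (m : nat -> {measure set orth -> \bar R}).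
Hypothesis mf : forall n, survival_of (m n) (f \o truncate n).

Let E n : set orth := upper_orthant (to_orthant (fun=> n.+1%:R^-1)).

Let measurable_E n : measurable (E n).
Proof. exact: measurable_upper_orthant. Qed.

Let measurable_shell n : measurable (seqD E n).
Proof. by case: n => [|n] /=; [|apply: measurableD]. Qed.

Let E_upper n x : upper_orthant x `&` E n = upper_orthant (truncate n x).
Proof.
rewrite /E upper_orthantI; congr upper_orthant; apply: orthantP => i.
by rewrite coord_truncate !coord_to_orthant// lt_max coord_gt0.
Qed.

Let truncate_truncate n k (x : orth) : (k <= n)%N ->
  truncate n (truncate k x) = truncate k x.
Proof.
move=> kn; apply: orthantP => i; rewrite !coord_truncate.
by rewrite -maxA (@max_l _ _ k.+1%:R^-1)// lef_pV2 ?posrE// ler_nat.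
Qed.

(** The measure [m n] is used on the [n]-th shell only.  On an upper orthant the
    shell masses telescope, and the sum becomes stationary once [1 / (n + 1)] is
    below all coordinates of the corner. *)
Lemma glue_measures : exists mu : {measure set orth -> \bar R}, survival_of mu f.
Proof.
exists (mseries (fun n => mrestr (m n) (measurable_shell n)) 0) => x.
have mE n k : (k <= n)%N ->
    m n (upper_orthant x `&` E k) = (f (truncate k x))%:E.
  by move=> kn; rewrite E_upper mf/= truncate_truncate.
have sumE n : (\sum_(0 <= k < n.+1) mrestr (m k) (measurable_shell k)
    (upper_orthant x) = (f (truncate n x))%:E)%E.
  elim: n => [|n IH]; first by rewrite big_nat1 /mrestr /= mE.
  rewrite big_nat_recr//= IH /mrestr/= setDE setIA -setDE.
  rewrite (measureD (mu := m n.+1))//; last 2 first.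
  - by apply: measurableI => //; exact: measurable_upper_orthant.
  - by rewrite [ltLHS](mE n.+1 n.+1)// ltry.
  rewrite -setIA (_ : E n.+1 `&` E n = E n); last first.
    apply/setIidPr; apply: subset_trans (_ : E n `<=` E n.+1) => // v H i.
    apply: le_trans (H i); rewrite !coord_to_orthant ?invr_gt0//.
    by rewrite lef_pV2 ?posrE// ler_nat.
  rewrite [X in (_ + (X - _))%E](mE n.+1 n.+1)//.
  by rewrite [X in (_ + (_ - X))%E](mE n.+1 n)// -EFinB -EFinD addrC subrK.
have [n0 xn0] := coord_bounded_away x.
have trE n : (n0 <= n)%N -> truncate n x = x.
  move=> n0n; apply: orthantP => i; rewrite coord_truncate max_l//.
  by rewrite (le_trans _ (xn0 i))// lef_pV2 ?posrE// ler_nat.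
rewrite /mseries; apply: cvg_lim => //.
apply: (cvg_near_cst (f x)%:E); exists n0.+1 => // -[//|n] /= n0n.
by rewrite sumE trE.
Qed.

End gluing.

(** * The mixing law of a survival function *)

(** Normalization leaves a measure of total mass one unchanged. *)
Lemma exists_probability {R : realType} disp (T : measurableType disp)
    (m : {measure set T -> \bar R}) : m setT = 1%E ->
  exists P : probability T R, forall A, P A = m A.
Proof.
move=> m1; exists (mnormalize m (dirac point : probability T R)) => A.
by rewrite /= /mnormalize m1 /= onee_eq0/= invr1 mule1.
Qed.

Section mixing_density.
Context {R : realType} {d : nat}.
Local Notation orth := (orthant R d).

(** A distribution function determines its law, so the chosen law is the
    original one. *)
Lemma law_dist_fun (P : probability orth R) A :
  measurable A -> law (dist_fun P) A = P A.
Proof.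
have fin (Q : probability orth R) x : (Q (lower_orthant x) < +oo)%E.
  apply: le_lt_trans (ltry 1); apply: probability_le1.
  exact: measurable_lower_orthant.
move: A; apply: measure_eq_lower_orthants => x; last exact: fin.
have dP : distribution_functions (dist_fun P) by exists P.
have := congr1 (fun G => (G x)%:E) (dist_fun_law dP).
by rewrite /dist_fun !fineK// ge0_fin_numE//; exact: fin.
Qed.

(** Both sides are the measure of the pairs with [u <= v] for the product of [mu]
    and Lebesgue measure. *)
Lemma integral_vol_survival (mu : {sigma_finite_measure set orth -> \bar R})
    (f : orth -> R) : survival_of mu f ->
  (\int[mu]_v (vol v)%:E = \int[@lebesgue_orthant R d]_u (f u)%:E)%E.
Proof.
move=> muf.
pose S : set (orth * orth) := [set p | forall i, coord p.2 i <= coord p.1 i].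
have mS : measurable S.
  apply: measurable_forall_ord => i.
  by apply: measurable_fun_ler;
    [exact: measurable_coord_snd|exact: measurable_coord_fst].
pose K (p : orth * orth) : \bar R := (\1_S p)%:E.
have mK : measurable_fun setT K.
  by apply/measurable_EFinP; exact: measurable_indic.
have K0 p : (0 <= K p)%E by rewrite lee_fin.
transitivity (\int[mu]_v \int[@lebesgue_orthant R d]_u K (v, u))%E.
  apply: eq_integral => v _; rewrite -lebesgue_lower_orthant /K/=.
  rewrite -[X in @lebesgue_orthant R d X]setIT -integral_indic//.
  exact: measurable_lower_orthant.
rewrite (fubini_tonelli (m1 := mu) (m2 := @lebesgue_orthant R d) K mK K0).
apply: eq_integral => u _; rewrite -muf /K/=.
rewrite -[X in mu X]setIT -integral_indic//.
exact: measurable_upper_orthant.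
Qed.

Lemma smu_density_of_survival (mu : {measure set orth -> \bar R})
    (f : orth -> R) : survival_of mu f ->
  (\int[@lebesgue_orthant R d]_u (f u)%:E = 1)%E -> smu_densities f.
Proof.
move=> muf f1.
have [nu nuE] : exists nu : {sigma_finite_measure set orth -> \bar R},
    nu = mu :> (set orth -> \bar R).
  apply: sigma_finite_measureP; apply: sigma_finite_upper_orthants => x.
  by rewrite muf ltry.
have nuf : survival_of nu f by rewrite nuE.
have [m mE] := exists_density nu measurable_vol (fun v => ltW (vol_gt0 v)).
have [P PE] : exists P : probability orth R, forall A, P A = m A.
  apply: exists_probability.
  have := mE setT (cst 1%E) measurableT (measurable_cst _) (fun=> lee01).
  rewrite integral_cst// mul1e => ->; rewrite -[RHS]f1 -(integral_vol_survival nuf).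
  by apply: eq_integral => v _; rewrite mul1e.
exists (dist_fun P); first by exists P.
apply/funext => x; rewrite /smu_density /Rintegral.
rewrite (eq_measure_integral m); last first.
  by move=> A mA _; exact: etrans (law_dist_fun P mA) (PE A).
rewrite mE; last 3 first.
- exact: measurable_upper_orthant.
- by apply/measurable_EFinP; apply: measurable_funTS; exact: measurable_inv_vol.
- by move=> v; rewrite lee_fin invr_ge0 ltW// vol_gt0.
under eq_integral => v _ do rewrite -EFinM mulVf ?gt_eqF ?vol_gt0//.
rewrite integral_cst; last exact: measurable_upper_orthant.
by rewrite mul1e [X in fine X]nuf.
Qed.

End mixing_density.

Theorem theorem2p3 (R : realType) (d : nat) (d_gt0 : (0 < d)%N) :
  (forall f : orthant R d -> R,
    smu_densities f <->
    exists (mu : {measure set (orthant R d) -> \bar R}) (G : orthant R d -> R),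
      [/\ extends_volume f mu,
          distribution_functions G,
          forall x : orthant R d,
            ((G x)%:E = \int[@lebesgue_orthant R d]_u
               (mu (box_oc u x) * (\1_[set w : orthant R d | ole w x] u)%:E))%E
        & f = smu_density G]) /\
  set_bij (@distribution_functions R d) (@smu_densities R d)
    (@smu_density R d) /\
  (forall f : orthant R d -> R,
    upper_semicontinuous f -> probability_density f ->
    vanishes_at_infinity_coordinatewise f ->
    (smu_densities f <->
     forall x y : orthant R d, ole x y -> 0 <= (-1) ^+ d * volume f x y)).
Proof.
split; last split.
- move=> f; split => [[G dG <-]|[_ [G [_ dG _ ->]]]]; last by exists G.
  have [mu muf GE] := exists_survival_measure dG.
  by exists mu, G; split => //; exact: survival_volume.
- split; [by move=> G dG; exists G|exact: smu_density_inj|by []].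
- move=> f f_usc [_ _ f1] f_vanish; split => [[G dG <-] x y xy|f_volume].
    have [mu muf _] := exists_survival_measure dG.
    by rewrite -lee_fin -(survival_volume muf xy).
  have /choice[m mE] := exists_truncated_measure f_usc f_vanish f_volume.
  have [mu muf] := glue_measures mE.
  exact: smu_density_of_survival muf f1.
Qed.
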